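(* Let $G$ be a finite group, let $k \rightarrow \ell$ be a map of $G$-Tambara functors, and let $R$ denote a $k$-algebra. The base-change functor $- \boxtimes_k \ell$ enjoys the following properties: (1) if $R$ is finitely presented over $k$, then $R \boxtimes_k \ell$ is finitely presented over $\ell$; (2) if $R$ is flat over $k$, then $R \boxtimes_k \ell$ is flat over $\ell$; (3) if $\Omega^{1,\mathrm{Tamb}}_{R/k} = 0$, then $\Omega^{1,\mathrm{Tamb}}_{R \boxtimes_k \ell/\ell} = 0$. Hence base-change preserves étale morphisms.
   Context: Mackey, (commutative) Green and Tambara functors for a finite group $G$ have their standard meaning: a $G$-Tambara functor $k$ has commutative rings $k(X)$ for finite $G$-sets $X$, with restrictions $\mathrm{Res}$, transfers $\mathrm{Tr}$ and norms $\mathrm{Nm}$. A module over a Tambara functor is a module over its underlying Green functor. A $k$-algebra is a Tambara functor $R$ with a morphism $k \to R$. $\boxtimes_k$ is the relative box product over $k$ (the coproduct of $k$-algebras). Étale. A $k$-module $M$ is flat if $M \boxtimes_k -$ is exact on $k$-modules. The free polynomial $k$-algebra on a generator in level $X$ ($X$ a finite $G$-set) is the $k$-algebra representing $R \mapsto R(X)$. A $k$-algebra is finitely presented if it is the coequalizer of a pair of maps between free polynomial $k$-algebras on finitely many generators. A Tambara ideal is the (levelwise) kernel of a morphism of Tambara functors. For a Tambara ideal $I$, $I^{>1}$ is the sub-ideal of $I$ generated by all nontrivial norms (including products) of elements of $I$: in level $G/H$ by $I(G/H)^2$ together with the images of all norms $I(G/K) \to I(G/H)$ for $K$ conjugate to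 a proper subgroup of $H$. For a $k$-algebra $R$ with $I = \ker(R \boxtimes_k R \to R)$ (multiplication), the genuine Kähler differentials are $\Omega^{1,\mathrm{Tamb}}_{R/k} := I/I^{>1}$. A morphism $k \to R$ is formally étale if $R$ is flat as a $k$-module and $\Omega^{1,\mathrm{Tamb}}_{R/k} = 0$; it is étale if it is moreover finitely presented. *)

(* Defs.v *)
From HB Require Import structures.
From mathcomp Require Import all_boot all_algebra all_fingroup.

Set Implicit Arguments.
Unset Strict Implicit.
Unset Printing Implicit Defensive.

Import GRing.Theory.
Local Open Scope ring_scope.

Section FiniteGSets.

Variable gT : finGroupType.

(* The actions of action.v are right actions; a left G-set is the same thing
   as a right G-set through inversion in G. *)
Record gset : Type := GSet {
  gset_sort :> finType;
  gset_act : {action gT &-> gset_sort}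
}.

Record gmap (X Y : gset) : Type := GMap {
  gmap_fun :> X -> Y;
  gmap_equiv : forall x g, gmap_fun (gset_act X x g) = gset_act Y (gmap_fun x) g
}.

Definition gmap_id (X : gset) : gmap X X :=
  @GMap X X (fun x => x) (fun _ _ => erefl).

Lemma gmap_comp_equiv (X Y Z : gset) (f : gmap Y Z) (h : gmap X Y) x g :
  f (h (gset_act X x g)) = gset_act Z (f (h x)) g.
Proof. by rewrite !gmap_equiv. Qed.

Definition gmap_comp (X Y Z : gset) (f : gmap Y Z) (h : gmap X Y) : gmap X Z :=
  GMap (gmap_comp_equiv f h).

Section Cosets.

Variable H : {group gT}.

Definition cosets : finType := {A : {set gT} | A \in rcosets H [set: gT]}.

Lemma cosets_act_subproof (A : cosets) (g : gT) :
  (val A :* g)%g \in rcosets H [set: gT].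
Proof.
case: A => A /= /rcosetsP[x _ ->].
by apply/rcosetsP; exists (x * g)%g; rewrite ?inE // rcosetM.
Qed.

Definition cosets_act (A : cosets) (g : gT) : cosets :=
  Sub (val A :* g)%g (cosets_act_subproof A g).

Lemma cosets_act1 : cosets_act^~ 1%g =1 id.
Proof. by move=> A; apply: val_inj; rewrite /= mulg1. Qed.

Lemma cosets_actM (A : cosets) : act_morph cosets_act A.
Proof. by move=> g h; apply: val_inj; rewrite /= rcosetM. Qed.

Definition coset_gset : gset := GSet (TotalAction cosets_act1 cosets_actM).

End Cosets.

Definition is_pullback (X Y Z W : gset) (f : gmap X Z) (h : gmap Y Z)
    (p : gmap W X) (q : gmap W Y) : Prop :=
  (forall w, f (p w) = h (q w)) /\
  (forall x y, f x = h y -> exists! w, p w = x /\ q w = y).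

Definition is_coproduct (X Y Z : gset) (i : gmap X Z) (j : gmap Y Z) : Prop :=
  [/\ injective i, injective j, (forall x y, i x <> j y) &
      forall z, (exists x, i x = z) \/ (exists y, j y = z)].

(* E -> Z is the dependent product of p : A -> X along f : X -> Z: the points
   of E over z are the sections of p over the fibre of f at z, and ev is the
   evaluation map on W = X x_Z E. *)
Definition is_exponential (A X Z E W : gset) (p : gmap A X) (f : gmap X Z)
    (e : gmap E Z) (w1 : gmap W X) (w2 : gmap W E) (ev : gmap W A) : Prop :=
  [/\ is_pullback f e w1 w2,
      (forall w, p (ev w) = w1 w) &
      forall (z : Z) (s : forall x, f x = z -> A),
        (forall x (fx : f x = z), p (s x fx) = x) ->
        exists! y : E, e y = z /\
          (forall w (fw : f (w1 w) = z), w2 w = y -> ev w = s (w1 w) fw)].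

End FiniteGSets.

Arguments gmap_id {gT X}.

Section Mackey.

Variable gT : finGroupType.
Implicit Types X Y Z W : gset gT.

(* Set-valued, so that it applies both to the additive functor (Res, Tr) and
   to the multiplicative functor (Res, Nm) of a Tambara functor. *)
Record semi_mackey (V : gset gT -> Type)
    (res : forall X Y, gmap X Y -> V Y -> V X)
    (tr : forall X Y, gmap X Y -> V X -> V Y) : Prop := SemiMackey {
  sm_res_id : forall X (a : V X), res X X gmap_id a = a;
  sm_res_comp : forall X Y Z (f : gmap Y Z) (h : gmap X Y) (a : V Z),
    res X Z (gmap_comp f h) a = res X Y h (res Y Z f a);
  sm_tr_id : forall X (a : V X), tr X X gmap_id a = a;
  sm_tr_comp : forall X Y Z (f : gmap Y Z) (h : gmap X Y) (a : V X),
    tr X Z (gmap_comp f h) a = tr Y Z f (tr X Y h a);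
  sm_pullback : forall X Y Z W (f : gmap X Z) (h : gmap Y Z)
      (p : gmap W X) (q : gmap W Y), is_pullback f h p q ->
    forall a : V X, res Y Z h (tr X Z f a) = tr W Y q (res W X p a);
  sm_empty : forall X, (X -> False) -> forall a b : V X, a = b;
  sm_coproduct : forall X Y Z (i : gmap X Z) (j : gmap Y Z),
    is_coproduct i j ->
    forall (a : V X) (b : V Y), exists! c : V Z, res X Z i c = a /\ res Y Z j c = b
}.

(* Levels are possibly zero rings: the level of the empty G-set is zero.
   Frobenius reciprocity tr_mul_res is redundant (it is an instance of nm_tr
   for fold maps); it is listed because it makes (res, tr) a Green functor.
   That the sum and the product are Tr and Nm along fold maps also follows. *)
Record tambara : Type := Tambara {
  level :> gset gT -> comPzRingType;
  res : forall X Y, gmap X Y -> {rmorphism level Y -> level X};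
  tr : forall X Y, gmap X Y -> {additive level X -> level Y};
  nm : forall X Y, gmap X Y -> level X -> level Y;
  nm1 : forall X Y (f : gmap X Y), nm f 1 = 1;
  nmM : forall X Y (f : gmap X Y), {morph nm f : a b / a * b};
  tr_mul_res : forall X Y (f : gmap X Y) a b, tr f (a * res f b) = tr f a * b;
  res_tr_mackey : @semi_mackey level (fun X Y f => res f) (fun X Y f => tr f);
  res_nm_mackey : @semi_mackey level (fun X Y f => res f) nm;
  nm_tr : forall A X Z E W (p : gmap A X) (f : gmap X Z) (e : gmap E Z)
      (w1 : gmap W X) (w2 : gmap W E) (ev : gmap W A),
    is_exponential p f e w1 w2 ev ->
    forall a : level A, nm f (tr p a) = tr e (nm w2 (res ev a))
}.

Record tambara_hom (S T : tambara) : Type := TambaraHom {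
  th_fun :> forall X, {rmorphism S X -> T X};
  th_res : forall X Y (f : gmap X Y) a, th_fun X (res S f a) = res T f (th_fun Y a);
  th_tr : forall X Y (f : gmap X Y) a, th_fun Y (tr S f a) = tr T f (th_fun X a);
  th_nm : forall X Y (f : gmap X Y) a, th_fun Y (nm f a) = nm f (th_fun X a)
}.

End Mackey.

Arguments res {gT t X Y}.
Arguments tr {gT t X Y}.

Section Modules.

Variables (gT : finGroupType) (k : tambara gT).
Implicit Types X Y : gset gT.

Record kmodule : Type := KModule {
  mlevel :> forall X, lmodType (k X);
  mres : forall X Y, gmap X Y -> {additive mlevel Y -> mlevel X};
  mtr : forall X Y, gmap X Y -> {additive mlevel X -> mlevel Y};
  m_mackey : @semi_mackey gT (fun X => mlevel X)
               (fun X Y f => mres f) (fun X Y f => mtr f);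
  mresZ : forall X Y (f : gmap X Y) (a : k Y) (m : mlevel Y),
    mres f (a *: m) = res f a *: mres f m;
  mtr_resl : forall X Y (f : gmap X Y) (a : k Y) (m : mlevel X),
    mtr f (res f a *: m) = a *: mtr f m;
  mtr_resr : forall X Y (f : gmap X Y) (a : k X) (m : mlevel Y),
    mtr f (a *: mres f m) = tr f a *: m
}.

Record kmodule_hom (M N : kmodule) : Type := KModuleHom {
  mh_fun :> forall X, {linear M X -> N X};
  mh_res : forall X Y (f : gmap X Y) m, mh_fun X (mres M f m) = mres N f (mh_fun Y m);
  mh_tr : forall X Y (f : gmap X Y) m, mh_fun Y (mtr M f m) = mtr N f (mh_fun X m)
}.

Definition short_exact (L M N : kmodule)
    (f : kmodule_hom L M) (h : kmodule_hom M N) : Prop :=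
  forall X, [/\ injective (f X), (forall n, exists m, h X m = n) &
                forall m, h X m = 0 <-> exists a, f X a = m].

(* k-bilinear Dress pairings. *)
Record pairing (M N T : kmodule) : Type := Pairing {
  pr_fun : forall X, M X -> N X -> T X;
  pr_linl : forall X (n : N X), linear (fun m : M X => pr_fun m n);
  pr_linr : forall X (m : M X), linear (fun n : N X => pr_fun m n);
  pr_res : forall X Y (f : gmap X Y) (m : M Y) (n : N Y),
    mres T f (pr_fun m n) = pr_fun (mres M f m) (mres N f n);
  pr_trl : forall X Y (f : gmap X Y) (m : M X) (n : N Y),
    mtr T f (pr_fun m (mres N f n)) = pr_fun (mtr M f m) n;
  pr_trr : forall X Y (f : gmap X Y) (m : M Y) (n : N X),
    mtr T f (pr_fun (mres M f m) n) = pr_fun m (mtr N f n)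
}.

(* The relative box product of k-modules, as the target of the universal
   k-bilinear Dress pairing; it is determined up to unique isomorphism. *)
Record module_box (M N : kmodule) : Type := ModuleBox {
  mb_obj :> kmodule;
  mb_pair : pairing M N mb_obj;
  mb_lift : forall T, pairing M N T -> kmodule_hom mb_obj T;
  mb_liftE : forall T (b : pairing M N T) X (m : M X) (n : N X),
    mb_lift b X (pr_fun mb_pair m n) = pr_fun b m n;
  mb_uniq : forall T (u v : kmodule_hom mb_obj T),
    (forall X (m : M X) (n : N X),
       u X (pr_fun mb_pair m n) = v X (pr_fun mb_pair m n)) ->
    forall X x, u X x = v X x
}.

Section PairingComp.

Variables (M N N' T : kmodule) (b : pairing M N' T) (f : kmodule_hom N N').

Let bf X (m : M X) (n : N X) : T X := pr_fun b m (f X n).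

Lemma pairing_comp_linl X (n : N X) : linear (fun m : M X => bf m n).
Proof. exact: pr_linl. Qed.

Lemma pairing_comp_linr X (m : M X) : linear (fun n : N X => bf m n).
Proof. by move=> a u v; rewrite /bf linearP pr_linr. Qed.

Lemma pairing_comp_res X Y (h : gmap X Y) (m : M Y) (n : N Y) :
  mres T h (bf m n) = bf (mres M h m) (mres N h n).
Proof. by rewrite /bf pr_res mh_res. Qed.

Lemma pairing_comp_trl X Y (h : gmap X Y) (m : M X) (n : N Y) :
  mtr T h (bf m (mres N h n)) = bf (mtr M h m) n.
Proof. by rewrite /bf mh_res pr_trl. Qed.

Lemma pairing_comp_trr X Y (h : gmap X Y) (m : M Y) (n : N X) :
  mtr T h (bf (mres M h m) n) = bf m (mtr N h n).
Proof. by rewrite /bf pr_trr mh_tr. Qed.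

Definition pairing_comp : pairing M N T :=
  Pairing pairing_comp_linl pairing_comp_linr pairing_comp_res
    pairing_comp_trl pairing_comp_trr.

End PairingComp.

Definition module_box_map (M N N' : kmodule) (B : module_box M N)
    (B' : module_box M N') (f : kmodule_hom N N') : kmodule_hom B B' :=
  mb_lift B (pairing_comp (mb_pair B') f).

(* T is the functor "M box_k -"; any two choices of T are naturally isomorphic. *)
Definition flat (M : kmodule) : Prop :=
  exists T : forall N, module_box M N,
    forall (N1 N2 N3 : kmodule) (f : kmodule_hom N1 N2) (h : kmodule_hom N2 N3),
      short_exact f h ->
      short_exact (module_box_map (T N1) (T N2) f) (module_box_map (T N2) (T N3) h).

End Modules.

Section Algebras.

Variables (gT : finGroupType) (k : tambara gT).
Implicit Types X Y : gset gT.

Record kalgebra : Type := KAlgebra {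
  alg_tambara :> tambara gT;
  alg_unit : tambara_hom k alg_tambara
}.

Record kalgebra_hom (R S : kalgebra) : Type := KAlgebraHom {
  ah_hom :> tambara_hom R S;
  ah_unit : forall X a, ah_hom X (alg_unit R X a) = alg_unit S X a
}.

Definition tambara_id (S : tambara gT) : tambara_hom S S :=
  @TambaraHom gT S S (fun X => idfun) (fun _ _ _ _ => erefl)
    (fun _ _ _ _ => erefl) (fun _ _ _ _ => erefl).

Definition kalgebra_id (R : kalgebra) : kalgebra_hom R R :=
  @KAlgebraHom R R (tambara_id R) (fun _ _ => erefl).

Section UnderlyingModule.

Variable R : kalgebra.

Section Level.

Variable X : gset gT.

Let scale (a : k X) (r : R X) : R X := alg_unit R X a * r.

Lemma alg_scaleA a b r : scale a (scale b r) = scale (a * b) r.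
Proof. by rewrite /scale rmorphM mulrA. Qed.

Lemma alg_scale1 : left_id 1 scale.
Proof. by move=> r; rewrite /scale rmorph1 mul1r. Qed.

Lemma alg_scaleDr : right_distributive scale +%R.
Proof. by move=> a r s; rewrite /scale mulrDr. Qed.

Lemma alg_scaleDl r : {morph scale^~ r : a b / a + b}.
Proof. by move=> a b; rewrite /scale rmorphD mulrDl. Qed.

Definition alg_lmod : lmodType (k X) :=
  HB.pack_for (lmodType (k X)) (R X)
    (GRing.Zmodule_isLmodule.Build (k X) (R X)
       alg_scaleA alg_scale1 alg_scaleDr alg_scaleDl).

End Level.

Let ares X Y (f : gmap X Y) : {additive alg_lmod Y -> alg_lmod X} :=
  (res f : {additive R Y -> R X}).

Let atr X Y (f : gmap X Y) : {additive alg_lmod X -> alg_lmod Y} := tr f.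

Lemma alg_mackey : @semi_mackey gT (fun X => alg_lmod X)
  (fun X Y f => ares f) (fun X Y f => atr f).
Proof. exact: (res_tr_mackey R). Qed.

Lemma alg_resZ X Y (f : gmap X Y) (a : k Y) (m : alg_lmod Y) :
  ares f (a *: m) = res f a *: ares f m.
Proof. by rewrite /GRing.scale /= rmorphM th_res. Qed.

Lemma alg_tr_resl X Y (f : gmap X Y) (a : k Y) (m : alg_lmod X) :
  atr f (res f a *: m) = a *: atr f m.
Proof.
rewrite /GRing.scale /= th_res.
by rewrite [LHS](congr1 (tr f) (mulrC _ _)) tr_mul_res mulrC.
Qed.

Lemma alg_tr_resr X Y (f : gmap X Y) (a : k X) (m : alg_lmod Y) :
  atr f (a *: ares f m) = tr f a *: m.
Proof. by rewrite /GRing.scale /= tr_mul_res th_tr. Qed.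

Definition alg_module : kmodule k :=
  KModule alg_mackey alg_resZ alg_tr_resl alg_tr_resr.

End UnderlyingModule.

(* The relative box product of k-algebras, i.e. their coproduct. *)
Record algebra_box (R S : kalgebra) : Type := AlgebraBox {
  ab_obj :> kalgebra;
  ab_inl : kalgebra_hom R ab_obj;
  ab_inr : kalgebra_hom S ab_obj;
  ab_lift : forall T : kalgebra,
    kalgebra_hom R T -> kalgebra_hom S T -> kalgebra_hom ab_obj T;
  ab_lift_inl : forall T (f : kalgebra_hom R T) (h : kalgebra_hom S T) X r,
    ab_lift f h X (ab_inl X r) = f X r;
  ab_lift_inr : forall T (f : kalgebra_hom R T) (h : kalgebra_hom S T) X s,
    ab_lift f h X (ab_inr X s) = h X s;
  ab_uniq : forall T (u v : kalgebra_hom ab_obj T),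
    (forall X r, u X (ab_inl X r) = v X (ab_inl X r)) ->
    (forall X s, u X (ab_inr X s) = v X (ab_inr X s)) ->
    forall X x, u X x = v X x
}.

Definition box_mul (R : kalgebra) (B : algebra_box R R) : kalgebra_hom B R :=
  ab_lift B (kalgebra_id R) (kalgebra_id R).

(* F represents R |-> R(X_0) x ... x R(X_(n-1)). *)
Record free_algebra (n : nat) (L : 'I_n -> gset gT) : Type := FreeAlgebra {
  fa_obj :> kalgebra;
  fa_gen : forall i, fa_obj (L i);
  fa_lift : forall R : kalgebra, (forall i, R (L i)) -> kalgebra_hom fa_obj R;
  fa_liftE : forall (R : kalgebra) (r : forall i, R (L i)) i,
    fa_lift r (L i) (fa_gen i) = r i;
  fa_uniq : forall (R : kalgebra) (u v : kalgebra_hom fa_obj R),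
    (forall i, u (L i) (fa_gen i) = v (L i) (fa_gen i)) ->
    forall X x, u X x = v X x
}.

Definition is_coequalizer (S T R : kalgebra) (u v : kalgebra_hom S T)
    (q : kalgebra_hom T R) : Prop :=
  (forall X x, q X (u X x) = q X (v X x)) /\
  (forall (R' : kalgebra) (f : kalgebra_hom T R'),
     (forall X x, f X (u X x) = f X (v X x)) ->
     exists h : kalgebra_hom R R', (forall X x, h X (q X x) = f X x) /\
       (forall h' : kalgebra_hom R R', (forall X x, h' X (q X x) = f X x) ->
          forall X y, h' X y = h X y)).

Definition finitely_presented (R : kalgebra) : Prop :=
  exists (m n : nat) (K : 'I_m -> gset gT) (L : 'I_n -> gset gT)
    (S : free_algebra K) (T : free_algebra L)
    (u v : kalgebra_hom S T) (q : kalgebra_hom T R), is_coequalizer u v q.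

End Algebras.

Section Ideals.

Variables (gT : finGroupType) (S : tambara gT).

Definition family : Type := forall X, S X -> Prop.

Definition ker (T : tambara gT) (f : tambara_hom S T) : family :=
  fun X x => f X x = 0.

Definition tambara_ideal (I : family) : Prop :=
  exists (T : tambara gT) (f : tambara_hom S T),
    forall X x, I X x <-> ker f x.

Definition ideal_generated (A : family) : family := fun X x =>
  forall I, tambara_ideal I -> (forall Y y, A Y y -> I Y y) -> I X x.

Inductive nontrivial_norm (I : family) : family :=
| NormProduct (H : {group gT}) a b :
    I (coset_gset H) a -> I (coset_gset H) b ->
    nontrivial_norm I (a * b)
| NormSubgroup (H K : {group gT}) (f : gmap (coset_gset K) (coset_gset H)) a :
    (exists g : gT, K :^ g \proper H)%g -> I (coset_gset K) a ->
    nontrivial_norm I (nm f a).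

(* I^{>1} *)
Definition ideal_gt1 (I : family) : family := ideal_generated (nontrivial_norm I).

End Ideals.

Section Kahler.

Variables (gT : finGroupType) (k : tambara gT).

Section Differentials.

Variables (R : kalgebra k) (B : algebra_box R R).

Let I : family B := ker (box_mul B).

(* I / I^{>1} in level X, as the set of cosets x + I^{>1}(X) with x in I(X). *)
Definition kahler (X : gset gT) (C : B X -> Prop) : Prop :=
  exists x, I x /\ forall y, C y <-> ideal_gt1 I (y - x).

Definition kahler_eq0 : Prop :=
  forall X (C : B X -> Prop), kahler C -> forall y, C y <-> ideal_gt1 I y.

End Differentials.

(* Any two choices of the box product B are isomorphic. *)
Definition kahler_trivial (R : kalgebra k) : Prop :=
  exists B : algebra_box R R, kahler_eq0 B.

Definition formally_etale (R : kalgebra k) : Prop :=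
  flat (alg_module R) /\ kahler_trivial R.

Definition etale (R : kalgebra k) : Prop :=
  formally_etale R /\ finitely_presented R.

Section BaseChange.

Variables (l : tambara gT) (phi : tambara_hom k l) (R : kalgebra k).

Definition base_change (B : algebra_box R (KAlgebra phi)) : kalgebra l :=
  KAlgebra (ab_inr B).

End BaseChange.

End Kahler.

(* Main.v *)
From HB Require Import structures.
Require Import Defs.
From mathcomp Require Import all_boot all_algebra all_fingroup.
From mathcomp Require Import boolp.

(* The box product of two k-algebras R and S is written down explicitly as a
   coend: its elements over X are the classes of triples (p : Y -> X, r in R(Y),
   s in S(Y)), thought of as Tr_p(r (x) s), modulo Frobenius reciprocity and
   k-bilinearity.  No formal sums are needed, since sums are triples on disjoint
   unions.  A norm sends such a class to the triple of norms on the dependent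
   product, and this respects Frobenius reciprocity because a dependent product
   of a composite Y' -> Y -> X is computed in two steps.  Hence the same set is
   at once the coproduct of k-algebras and the universal target of k-bilinear
   Dress pairings.

   (1) and (3) use only the universal properties: l-algebra maps out of a base
   change are k-algebra maps out of the original algebra.  For (2), the coend
   R box_k N of an l-module N carries an l-module structure through N and is
   then the box product over l of R box_k l with N, so exactness over l is
   exactness over k of R box_k -. *)

Set Implicit Arguments.
Unset Strict Implicit.
Unset Printing Implicit Defensive.

Import GRing.Theory.
Local Open Scope ring_scope.

Local Notation "f '\og' h" := (gmap_comp f h) (at level 50, left associativity).

(** * Finite G-sets: equivariant maps, pullbacks, disjoint unions, dependent products *)

Section GSets.

Variable gT : finGroupType.
Implicit Types X Y Z W A E : gset gT.

Local Notation "x ** g" := (gset_act _ x g) (at level 40, left associativity).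

(** Two things force an explicit construction. Existence: a presentation of the base change needs
    base changes of two free algebras, and the differentials need one of [R] boxed with itself, none
    of which is given. Elements: [B] is arbitrary and known only through maps of algebras out of it,
    which does not say how it pairs with modules; comparing it with the coend gives each of its
    elements a triple.

    Fold maps do all the algebra. Addition is transfer along a fold and multiplication is norm along
    a fold, so the ring axioms on the coend reduce to identities between finite G-sets: Frobenius
    reciprocity is a dependent product along a fold, and distributivity is Frobenius reciprocity for
    a fold.

    Norms are not additive, so a quotient of a free abelian group would not let them descend
    directly. The coend is a bare quotient of triples, a function descends as soon as it respects
    the three generating relations, and the group structure is put on afterwards. *)

Lemma gmap_ext X Y (f h : gmap X Y) : f =1 h -> f = h.
Proof.
case: f h => [f fe] [h he] /= /funext fh; case: _ / fh he => he.
by congr GMap; apply: Prop_irrelevance.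
Qed.

Lemma gmap_compA X Y Z W (f : gmap Z W) (h : gmap Y Z) (g : gmap X Y) :
  f \og (h \og g) = f \og h \og g.
Proof. exact: gmap_ext. Qed.

(** Uniqueness forces equivariance: [f (x ** g)] and [f x ** g] both satisfy [Q (x ** g)]. Maps into
    pullbacks and between dependent products are obtained in this way from their pointwise
    descriptions. *)
Lemma gmap_exists X Y (Q : X -> Y -> Prop) :
    (forall x, exists! y, Q x y) ->
    (forall x y g, Q x y -> Q (x ** g) (y ** g)) ->
  exists f : gmap X Y, forall x, Q x (f x).
Proof.
move=> Qf Qe; have [f fP] : {f : X -> Y | forall x, Q x (f x)}.
  by exists (fun x => sval (cid (Qf x))) => x; case: (cid (Qf x)) => y [].
have fe x g : f (x ** g) = f x ** g.
  have [y [_ yU]] := Qf (x ** g).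
  by rewrite -(yU _ (fP _)) (yU (f x ** g)) //; apply: Qe.
by exists (GMap fe).
Qed.

Lemma gmap_bij X Y (f : gmap X Y) : injective f -> (forall y, exists x, f x = y) ->
  exists h : gmap Y X, cancel f h /\ cancel h f.
Proof.
move=> fi fs; have [y|y x g <-|h hP] := @gmap_exists Y X (fun y x => f x = y).
- by have [x fx] := fs y; exists x; split=> // x' fx'; apply: fi; rewrite fx.
- exact: gmap_equiv.
by exists h; split=> // x; apply: fi.
Qed.

(** * Pullbacks *)

Lemma pb_sym X Y Z W (f : gmap X Z) (h : gmap Y Z) (p : gmap W X) (q : gmap W Y) :
  is_pullback f h p q -> is_pullback h f q p.
Proof.
case=> c u; split=> [w|y x fxy]; first by rewrite c.
have [w [[pw qw] wU]] := u x y (esym fxy).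
by exists w; split=> // w' [qw' pw']; apply: wU.
Qed.

Lemma pb_inj X Y Z W (f : gmap X Z) (h : gmap Y Z) (p : gmap W X) (q : gmap W Y) :
  is_pullback f h p q -> forall w w', p w = p w' -> q w = q w' -> w = w'.
Proof.
case=> c u w w' pw qw; have [v [_ vU]] := u _ _ (c w).
by rewrite -(vU w) // (vU w').
Qed.

Lemma pb_ex X Y Z W (f : gmap X Z) (h : gmap Y Z) (p : gmap W X) (q : gmap W Y) :
  is_pullback f h p q -> forall x y, f x = h y -> exists w, p w = x /\ q w = y.
Proof. by case=> c u x y /u [w [wP _]]; exists w. Qed.

Lemma pbI X Y Z W (f : gmap X Z) (h : gmap Y Z) (p : gmap W X) (q : gmap W Y) :
    (forall w, f (p w) = h (q w)) ->
    (forall w w', p w = p w' -> q w = q w' -> w = w') ->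
    (forall x y, f x = h y -> exists w, p w = x /\ q w = y) ->
  is_pullback f h p q.
Proof.
move=> c i e; split=> // x y /e [w [pw qw]]; exists w; split=> // w' [pw' qw'].
by apply: i; rewrite ?pw ?qw.
Qed.

Lemma pb_map X Y Z W (f : gmap X Z) (h : gmap Y Z) (p : gmap W X) (q : gmap W Y)
    V (u : gmap V X) (v : gmap V Y) :
    is_pullback f h p q -> (forall x, f (u x) = h (v x)) ->
  exists t : gmap V W, (forall x, p (t x) = u x) /\ (forall x, q (t x) = v x).
Proof.
move=> [c pb] uv.
have [x|x w g [pw qw]|t tP] := @gmap_exists V W (fun x w => p w = u x /\ q w = v x).
- by have [w [wP wU]] := pb _ _ (uv x); exists w; split.
- by rewrite !gmap_equiv pw qw.
by exists t; split=> x; have [] := tP x.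
Qed.

Lemma pb_paste X Y Z W Y' W' (f : gmap X Z) (h : gmap Y Z) (p : gmap W X)
    (q : gmap W Y) (g : gmap Y' Y) (p' : gmap W' W) (q' : gmap W' Y') :
    is_pullback f h p q -> is_pullback q g p' q' ->
  is_pullback f (h \og g) (p \og p') q'.
Proof.
move=> P1 P2; apply: pbI => [w|w w' /= pw qw|x y /= fxy].
- by rewrite /= P1.1 P2.1.
- apply: (pb_inj P2) => //; apply: (pb_inj P1) => //.
  by rewrite !P2.1 qw.
have [w [pw qw]] := pb_ex P1 fxy; have [w' [pw' qw']] := pb_ex P2 qw.
by exists w'; rewrite pw' pw.
Qed.

Lemma pb_id X Y (f : gmap X Y) : is_pullback f gmap_id gmap_id f.
Proof. by apply: pbI => // x y /= fxy; exists x. Qed.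

Lemma pb_mono X Y (f : gmap X Y) : injective f -> is_pullback f f gmap_id gmap_id.
Proof. by move=> fi; apply: pbI => //= x y /fi ->; exists y. Qed.

Lemma pb_iso X Y (f : gmap X Y) (h : gmap Y X) :
  cancel f h -> cancel h f -> is_pullback gmap_id f gmap_id h.
Proof.
by move=> fK hK; apply: pbI => //= y x ->; exists (f x).
Qed.

Section PullbackGSet.

Variables (X Y Z : gset gT) (f : gmap X Z) (h : gmap Y Z).

Definition pbk_type : finType := {u : X * Y | f u.1 == h u.2}.

Lemma pbk_act_subproof (u : pbk_type) (g : gT) :
  f ((val u).1 ** g) == h ((val u).2 ** g).
Proof. by rewrite !gmap_equiv (eqP (valP u)). Qed.

Definition pbk_act (u : pbk_type) (g : gT) : pbk_type :=
  exist _ ((val u).1 ** g, (val u).2 ** g) (pbk_act_subproof u g).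

Lemma pbk_act1 : pbk_act^~ 1%g =1 id.
Proof. by case=> -[x y] fxy; apply: val_inj; rewrite /= !act1. Qed.

Lemma pbk_actM u : act_morph pbk_act u.
Proof. by move=> a b; apply: val_inj; rewrite /= !actM. Qed.

Definition pbk : gset gT := GSet (TotalAction pbk_act1 pbk_actM).

Definition pbk1 : gmap pbk X :=
  @GMap _ pbk X (fun u => (val u).1) (fun _ _ => erefl).
Definition pbk2 : gmap pbk Y :=
  @GMap _ pbk Y (fun u => (val u).2) (fun _ _ => erefl).

Lemma pbkP : is_pullback f h pbk1 pbk2.
Proof.
apply: pbI => [u|u v uv1 uv2|x y fxy]; first exact: (eqP (valP u)).
  by apply: val_inj; case: u v uv1 uv2 => -[? ?] ? [[? ?] ?] /= -> ->.
by exists (exist (fun u : X * Y => f u.1 == h u.2) (x, y) (introT eqP fxy)).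
Qed.

End PullbackGSet.

(** * Coproducts *)

Lemma void_act1 : (fun (x : void) (g : gT) => x)^~ 1%g =1 id.
Proof. by []. Qed.

Lemma void_actM (x : void) : act_morph (fun (x : void) (g : gT) => x) x.
Proof. by []. Qed.

Definition gvoid : gset gT := GSet (TotalAction void_act1 void_actM).

Definition from_void X : gmap gvoid X :=
  @GMap _ gvoid X (of_void X) (fun x => match x with end).

Lemma pb_void X Y Z (f : gmap X Z) (h : gmap Y Z) :
  (forall x y, f x <> h y) -> is_pullback f h (from_void X) (from_void Y).
Proof. by move=> fh; apply: pbI => [[]|[]|x y /fh]. Qed.

Section Sum.

Variables (X Y : gset gT).

Definition gsum_act (u : X + Y) (g : gT) : X + Y :=
  match u with inl x => inl (x ** g) | inr y => inr (y ** g) end.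

Lemma gsum_act1 : gsum_act^~ 1%g =1 id.
Proof. by case=> x; rewrite /= act1. Qed.

Lemma gsum_actM u : act_morph gsum_act u.
Proof. by case: u => x a b; rewrite /= actM. Qed.

Definition gsum : gset gT := GSet (TotalAction gsum_act1 gsum_actM).

Definition gl : gmap X gsum := @GMap _ X gsum inl (fun _ _ => erefl).
Definition gr : gmap Y gsum := @GMap _ Y gsum inr (fun _ _ => erefl).

Lemma gl_inj : injective gl. Proof. by move=> x y []. Qed.
Lemma gr_inj : injective gr. Proof. by move=> x y []. Qed.

Lemma gsumP : is_coproduct gl gr.
Proof.
by split; [exact: gl_inj|exact: gr_inj|by []|case=> x; [left|right]; exists x].
Qed.

Definition case_fun Z (f : gmap X Z) (h : gmap Y Z) (u : X + Y) : Z :=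
  match u with inl x => f x | inr y => h y end.

Lemma case_equiv Z (f : gmap X Z) (h : gmap Y Z) (u : gsum) g :
  case_fun f h (u ** g) = case_fun f h u ** g.
Proof. by case: u => x /=; rewrite gmap_equiv. Qed.

Definition gcase Z (f : gmap X Z) (h : gmap Y Z) : gmap gsum Z :=
  GMap (case_equiv f h).

End Sum.

Definition gplus X Y X' Y' (f : gmap X X') (h : gmap Y Y') :
  gmap (gsum X Y) (gsum X' Y') := gcase (gl X' Y' \og f) (gr X' Y' \og h).

Definition gfold X : gmap (gsum X X) X := gcase gmap_id gmap_id.

Lemma pb_plusl X Y X' Y' (f : gmap X X') (h : gmap Y Y') :
  is_pullback (gplus f h) (gl X' Y') (gl X Y) f.
Proof.
apply: pbI => [//|x y [] //|[x|x] y] //= [<-].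
by exists x.
Qed.

Lemma pb_plusr X Y X' Y' (f : gmap X X') (h : gmap Y Y') :
  is_pullback (gplus f h) (gr X' Y') (gr X Y) h.
Proof.
apply: pbI => [//|x y [] //|[x|x] y] //= [<-].
by exists x.
Qed.

Lemma pb_case X Y Z X' Y' Z' (f : gmap X Z) (h : gmap Y Z) (g : gmap Z' Z)
    (p : gmap X' X) (q : gmap X' Z') (p' : gmap Y' Y) (q' : gmap Y' Z') :
    is_pullback f g p q -> is_pullback h g p' q' ->
  is_pullback (gcase f h) g (gplus p p') (gcase q q').
Proof.
move=> P P'; apply: pbI => [[x|x] /=|[x|x] [y|y] //= []|[x|x] y /= fxy].
- exact: P.1.
- exact: P'.1.
- by move=> pxy qxy; rewrite (pb_inj P pxy qxy).
- by move=> pxy qxy; rewrite (pb_inj P' pxy qxy).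
- by have [w [<- <-]] := pb_ex P fxy; exists (inl w).
- by have [w [<- <-]] := pb_ex P' fxy; exists (inr w).
Qed.

Lemma pb_fold X Y (f : gmap X Y) : is_pullback (gfold Y) f (gplus f f) (gfold X).
Proof. by apply: pb_case; apply: pb_sym; apply: pb_id. Qed.

(** * Exponentials *)

(** A section over the fibre at [z] is encoded by its image, a predicate on [A]. This avoids
    functions that take a proof of [f x = z] as an argument. *)
Definition is_section A X Z (p : gmap A X) (f : gmap X Z) (z : Z) (P : A -> Prop) :=
  (forall a, P a -> f (p a) = z) /\ forall x, f x = z -> exists! a, P a /\ p a = x.

Section ExponentialElim.

Variables (A X Z E W : gset gT) (p : gmap A X) (f : gmap X Z) (e : gmap E Z).
Variables (w1 : gmap W X) (w2 : gmap W E) (ev : gmap W A).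

(** Trades the dependent functions of [is_exponential] for two conditions: a point is determined by
    its evaluations, and every section is realised. Proof irrelevance for [f x = z] allows a
    dependent function to be replaced by its image. [expo_inj] and [expo_ex] recover the two
    conditions. *)
Lemma expoI :
    is_pullback f e w1 w2 -> (forall w, p (ev w) = w1 w) ->
    (forall y y', e y = e y' ->
      (forall w w', w2 w = y -> w2 w' = y' -> w1 w = w1 w' -> ev w = ev w') ->
      y = y') ->
    (forall z P, is_section p f z P ->
      exists y, e y = z /\ forall w, w2 w = y -> P (ev w)) ->
  is_exponential p f e w1 w2 ev.
Proof.
move=> pb pev inj ex; split=> // z s sP.
have sE x x' (fx : f x = z) (fx' : f x' = z) : x = x' -> s x fx = s x' fx'.
  by move=> xx; subst x'; rewrite (Prop_irrelevance fx fx').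
have [|y [ey yP]] := ex z (fun a => exists fa : f (p a) = z, s (p a) fa = a).
  split=> [a []|x fx] //; exists (s x fx); split=> [|a [[fa sa] pa]].
    2: by rewrite -[RHS]sa; apply: sE.
  split; last exact: sP.
  have fa : f (p (s x fx)) = z by rewrite sP.
  by exists fa; apply: sE.
have evE w (fw : f (w1 w) = z) : w2 w = y -> ev w = s (w1 w) fw.
  by move=> /yP [fa <-]; apply: sE; rewrite pev.
exists y; split=> // y' [ey' y'P]; apply: inj => [|w w' wy wy' ww']; first by rewrite ey.
have fw : f (w1 w) = z by rewrite pb.1 wy.
have fw' : f (w1 w') = z by rewrite pb.1 wy'.
by rewrite (evE _ fw wy) (y'P _ fw' wy'); apply: sE.
Qed.

Hypothesis expo : is_exponential p f e w1 w2 ev.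

Lemma expo_pb : is_pullback f e w1 w2. Proof. by case: expo. Qed.
Lemma expo_ev w : p (ev w) = w1 w. Proof. by case: expo. Qed.

Lemma expo_sec y : is_section p f (e y) (fun a => exists w, w2 w = y /\ ev w = a).
Proof.
split=> [a [w [<- <-]]|x fx]; first by rewrite expo_ev expo_pb.1.
have [w [wx wy]] := pb_ex expo_pb fx.
exists (ev w); split=> [|a [[w' [wy' <-]]]]; first by rewrite expo_ev; split=> //; exists w.
by rewrite expo_ev => wx'; congr (ev _); apply: (pb_inj expo_pb); rewrite ?wx ?wy.
Qed.

Lemma expo_ex z P : is_section p f z P ->
  exists y, e y = z /\ forall w, w2 w = y -> P (ev w).
Proof.
case: expo => pb pev U [Pz PU].
have sP x (fx : f x = z) : {a | P a /\ p a = x}.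
  by apply: cid; have [a [aP _]] := PU x fx; exists a.
have [|y [[ey yP] _]] := U z (fun x fx => sval (sP x fx)).
  by move=> x fx; case: (sP x fx) => a [].
exists y; split=> // w wy; have fw : f (w1 w) = z by rewrite pb.1 wy.
by rewrite (yP _ fw wy); case: (sP _ _) => a [].
Qed.

Lemma expo_inj y y' : e y = e y' ->
    (forall w w', w2 w = y -> w2 w' = y' -> w1 w = w1 w' -> ev w = ev w') ->
  y = y'.
Proof.
case: expo => pb pev U ee evE.
have sP x (fx : f x = e y) : {w | w1 w = x /\ w2 w = y}.
  by apply: cid; exact: pb_ex pb _ _ fx.
have [|v [_ vU]] := U (e y) (fun x fx => ev (sval (sP x fx))).
  by move=> x fx; case: (sP x fx) => w [] /= <-.
rewrite -(vU y) 1?(vU y') //; split=> // w fw wy; case: (sP _ _) => w' /= [ww' wy'].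
  by symmetry; apply: evE.
by congr (ev _); apply: (pb_inj pb); rewrite ?wy.
Qed.

End ExponentialElim.

Section ExponentialMap.

Variables (A X Z E W E' W' : gset gT) (p : gmap A X) (f : gmap X Z).
Variables (e : gmap E Z) (w1 : gmap W X) (w2 : gmap W E) (ev : gmap W A).
Variables (e' : gmap E' Z) (w1' : gmap W' X) (w2' : gmap W' E') (ev' : gmap W' A).
Hypothesis H : is_exponential p f e w1 w2 ev.
Hypothesis H' : is_exponential p f e' w1' w2' ev'.

(** A point of [E] is a section of [p], and the same section is the image of exactly one point of
    [E']. *)
Lemma expo_map : exists t : gmap E E', (forall y, e' (t y) = e y) /\
  forall w w', w2' w' = t (w2 w) -> w1 w = w1' w' -> ev' w' = ev w.
Proof.
pose Q y y' := e' y' = e y /\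
  forall w w', w2 w = y -> w2' w' = y' -> w1 w = w1' w' -> ev' w' = ev w.
have Qe y y' g : Q y y' -> Q (y ** g) (y' ** g).
  move=> [ee evE]; split=> [|w w' wy wy' ww']; first by rewrite !gmap_equiv ee.
  apply: (act_inj (gset_act A) g^-1%g); rewrite -!gmap_equiv.
  by apply: evE; rewrite !gmap_equiv ?ww' ?wy ?wy' ?actK.
have Qr y : exists! y', Q y y'.
  have [y' [ey yP]] := expo_ex H' (expo_sec H y).
  have evE w w' : w2 w = y -> w2' w' = y' -> w1 w = w1' w' -> ev' w' = ev w.
    move=> wy /yP [w0 [wy0 evE]] ww'; rewrite -evE; congr (ev _).
    apply: (pb_inj (expo_pb H)); last by rewrite wy.
    by rewrite ww' -(expo_ev H w0) evE (expo_ev H').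
  exists y'; split=> // y'' [ey' y'P].
  apply: (expo_inj H'); first by rewrite ey.
  move=> a b ay bz ab.
  have [|w [wa wy]] := @pb_ex _ _ _ _ _ _ _ _ (expo_pb H) (w1' a) y.
    by rewrite (expo_pb H').1 ay.
  by rewrite (y'P w b) -?ab // (evE w a).
have [t tQ] := gmap_exists Qr Qe; exists t; split=> [y|w w'].
  by have [] := tQ y.
by have [_] := tQ (w2 w); apply.
Qed.

End ExponentialMap.

(** Besides the bijection [t], a pullback square between the evaluation sets is recorded: it is what
    lets a restriction along [t] pass through a norm along [w2']. *)
Lemma expo_unique A X Z E W E' W' (p : gmap A X) (f : gmap X Z)
    (e : gmap E Z) (w1 : gmap W X) (w2 : gmap W E) (ev : gmap W A)
    (e' : gmap E' Z) (w1' : gmap W' X) (w2' : gmap W' E') (ev' : gmap W' A) :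
    is_exponential p f e w1 w2 ev -> is_exponential p f e' w1' w2' ev' ->
  exists (t : gmap E E') (t' : gmap E' E) (u : gmap W W'),
    [/\ cancel t t', cancel t' t, (forall y, e' (t y) = e y),
        is_pullback w2' t u w2 & forall w, ev' (u w) = ev w].
Proof.
move=> H H'; have [t [et evt]] := expo_map H H'; have [t' [et' evt']] := expo_map H' H.
have [u [u1 u2]] := @pb_map _ _ _ _ _ _ _ _ _ w1 (t \og w2) (expo_pb H') 
   (fun w => etrans ((expo_pb H).1 w) (esym (et (w2 w)))).
have pb_E w' y : f (w1' w') = e y -> exists w, w1 w = w1' w' /\ w2 w = y.
  exact: pb_ex (expo_pb H) _ _.
have pb_E' w y' : f (w1 w) = e' y' -> exists w', w1' w' = w1 w /\ w2' w' = y'.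
  exact: pb_ex (expo_pb H') _ _.
exists t, t', u; split=> // [y|y||w].
- apply: (expo_inj H) => [|w w' wy wy' ww']; first by rewrite et' et.
  have [|v [vw vy]] := pb_E' w (t y); first by rewrite (expo_pb H).1 wy et'.
  by rewrite -(evt w' v) ?vw ?vy ?wy' // (evt' v w) ?wy ?vy.
- apply: (expo_inj H') => [|w w' wy wy' ww']; first by rewrite et et'.
  have [|v [vw vy]] := pb_E w (t' y); first by rewrite (expo_pb H').1 wy et.
  by rewrite -(evt' w' v) ?vw ?vy ?wy' // (evt v w) ?wy ?vy.
- apply: pbI => [w|a b ab|w' y wy]; first by rewrite u2.
    by apply: (pb_inj (expo_pb H)); rewrite -u1 ab u1.
  have [|w [ww wy']] := pb_E w' y; first by rewrite (expo_pb H').1 wy et.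
  by exists w; split=> //; apply: (pb_inj (expo_pb H')); rewrite ?u1 // u2 /= wy' wy.
- by apply: evt; rewrite ?u1 ?u2.
Qed.

Section ExponentialGSet.

Variables (A X Z : gset gT) (p : gmap A X) (f : gmap X Z).

(* The section over z is encoded by its image B in A, so that the points of
   X x_Z E are the pairs of such a (z, B) and an element of B. *)
Definition expo_pred (u : Z * {set A}) :=
  [forall (a | a \in u.2), f (p a) == u.1] &&
  [forall (x | f x == u.1), #|[set a in u.2 | p a == x]| == 1%N].

Definition expo_type : finType := {u : Z * {set A} | expo_pred u}.

Lemma expo_predP (u : Z * {set A}) :
  reflect (is_section p f u.1 (fun a => a \in u.2)) (expo_pred u).
Proof.
apply: (iffP andP) => [[/forall_inP uf /forall_inP uc]|[uf uc]]; split.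
- by move=> a /uf /eqP.
- move=> x /eqP /uc /cards1P [a aE].
  have aP b : (b \in u.2) && (p b == x) = (b == a).
    by rewrite -[_ == a]in_set1 -aE inE.
  have /andP [ua /eqP pa] : (a \in u.2) && (p a == x) by rewrite aP.
  by exists a; split=> // b [ub pb]; apply/esym/eqP; rewrite -aP ub pb eqxx.
- by apply/forall_inP => a /uf ->.
- apply/forall_inP => x /eqP /uc [a [[ua pa] aU]]; apply/cards1P; exists a.
  apply/setP => b; rewrite !inE; apply/andP/eqP => [[ub /eqP pb]|->].
    by apply/esym/aU.
  by rewrite ua pa eqxx.
Qed.

Lemma expo_act_subproof (u : expo_type) (g : gT) :
  expo_pred ((val u).1 ** g, [set a | a ** g^-1%g \in (val u).2]).
Proof.
case: u => u /= /expo_predP [uf uc]; apply/expo_predP; split=> [a|x fx] /=.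
  rewrite inE => /uf; rewrite !gmap_equiv => <-.
  by rewrite actKV.
have [|a [[ua pa] aU]] := uc (x ** g^-1)%g; first by rewrite gmap_equiv fx /= actK.
exists (a ** g); split=> [|b []] /=; rewrite inE.
  by rewrite actK gmap_equiv pa actKV.
move=> ub pb; rewrite (aU (b ** g^-1)%g) ?actKV //.
by rewrite gmap_equiv pb.
Qed.

Definition expo_act (u : expo_type) (g : gT) : expo_type :=
  exist _ ((val u).1 ** g, [set a | a ** g^-1%g \in (val u).2]) (expo_act_subproof u g).

Lemma expo_act1 : expo_act^~ 1%g =1 id.
Proof.
case=> -[z B] u; apply: val_inj; rewrite /= act1; congr pair.
by apply/setP => a; rewrite inE invg1 act1.
Qed.

Lemma expo_actM u : act_morph expo_act u.
Proof.
move=> g h; apply: val_inj; rewrite /= actM; congr pair.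
by apply/setP => a; rewrite !inE invMg actM.
Qed.

Definition expo : gset gT := GSet (TotalAction expo_act1 expo_actM).

Definition expo_e : gmap expo Z :=
  @GMap _ expo Z (fun u => (val u).1) (fun _ _ => erefl).

Definition expo_pts_type : finType := {v : A * expo | v.1 \in (val v.2).2}.

Lemma expo_pts_act_subproof (v : expo_pts_type) (g : gT) :
  (val v).1 ** g \in (val ((val v).2 ** g : expo)).2.
Proof. by rewrite /= inE actK; exact: valP v. Qed.

Definition expo_pts_act (v : expo_pts_type) (g : gT) : expo_pts_type :=
  exist (fun v : A * expo => v.1 \in (val v.2).2) ((val v).1 ** g, (val v).2 ** g)
    (expo_pts_act_subproof v g).

Lemma expo_pts_act1 : expo_pts_act^~ 1%g =1 id.
Proof.
by case=> -[a u] ?; apply: val_inj; congr pair; [apply: act1|apply: expo_act1].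
Qed.

Lemma expo_pts_actM v : act_morph expo_pts_act v.
Proof.
by move=> g h; apply: val_inj; congr pair; [apply: actM|apply: expo_actM].
Qed.

Definition expo_pts : gset gT := GSet (TotalAction expo_pts_act1 expo_pts_actM).

Definition expo_eval : gmap expo_pts A :=
  @GMap _ expo_pts A (fun v => (val v).1) (fun _ _ => erefl).
Definition expo_w2 : gmap expo_pts expo :=
  @GMap _ expo_pts expo (fun v => (val v).2) (fun _ _ => erefl).

Lemma expoP : is_exponential p f expo_e (p \og expo_eval) expo_w2 expo_eval.
Proof.
have uP (u : expo) : is_section p f (val u).1 (fun a => a \in (val u).2).
  by apply/expo_predP; exact: valP u.
apply: expoI => //.
- apply: pbI => [v|v v' pv wv|x u fx].
  + by apply: (uP (val v).2).1; exact: valP v.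
  + have [_ /(_ (p (val v).1))] := uP (val v).2; case=> [|a [_ aU]].
      by apply: (uP (val v).2).1; exact: valP v.
    have vv' : (val v).1 = (val v').1.
      rewrite -(aU (val v).1) ?(aU (val v').1) //; split=> //.
        by rewrite [(val v).2]wv; exact: valP v'.
      exact: valP v.
    by apply: val_inj; rewrite [LHS]surjective_pairing [RHS]surjective_pairing vv' [(val v).2]wv.
  have [_ /(_ x fx) [a [[ua pa] _]]] := uP u.
  by exists (exist (fun v : A * expo => v.1 \in (val v.2).2) (a, u) ua).
- have sub (u u' : expo) : expo_e u = expo_e u' ->
    (forall w w', expo_w2 w = u -> expo_w2 w' = u' -> (p \og expo_eval) w = (p \og expo_eval) w' ->
      expo_eval w = expo_eval w') -> (val u).2 \subset (val u').2.
    move=> ee evE; apply/subsetP => a ua.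
    have [uf _] := uP u; have [_ /(_ (p a))] := uP u'; case=> [|b [[ub pb] _]].
      by rewrite uf.
    have := evE (exist (fun v : A * expo => v.1 \in (val v.2).2) (a, u) ua)
      (exist (fun v : A * expo => v.1 \in (val v.2).2) (b, u') ub) erefl erefl (esym pb).
    by move=> /= ->.
  move=> u u' ee evE; apply: val_inj.
  rewrite [LHS]surjective_pairing [RHS]surjective_pairing [(val u).1]ee.
  congr pair; apply/eqP; rewrite eqEsubset !sub // => w w' wu wu' ww'.
  by symmetry; apply: evE.
(* Classically the propositional section [P] is decidable, so its image is a finite set and hence a
   point of [expo]. *)
move=> z P zP; have Pz : expo_pred (z, [set a | `[< P a >]]).
  have aP a : (a \in [set a | `[< P a >]]) = P a :> Prop.
    by rewrite inE asboolE.
  by apply/expo_predP; rewrite /= (funext aP).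
exists (exist (fun u => expo_pred u) _ Pz); split=> // -[[a u] /= ua] /= uE.
by move: ua; rewrite uE /= inE => /asboolP.
Qed.

End ExponentialGSet.

(** A section of [p \og g] is a section of [p], that is a point [y] of [E], together with a lift to
    [A'] of each value [ev w] with [w2 w = y]. Such a family of lifts is a section of [v1] along
    [w2]. *)
Lemma expo_comp_p A X Z E W A' V E' U (p : gmap A X) (f : gmap X Z)
    (e : gmap E Z) (w1 : gmap W X) (w2 : gmap W E) (ev : gmap W A)
    (g : gmap A' A) (v1 : gmap V W) (v2 : gmap V A')
    (e' : gmap E' E) (u1 : gmap U W) (u2 : gmap U E') (ev' : gmap U V) :
    is_exponential p f e w1 w2 ev -> is_pullback ev g v1 v2 ->
    is_exponential v1 w2 e' u1 u2 ev' ->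
  is_exponential (p \og g) f (e \og e') (w1 \og u1) u2 (v2 \og ev').
Proof.
move=> H PV H'; apply: expoI.
- exact: pb_paste (expo_pb H) (expo_pb H').
- by move=> u /=; rewrite -PV.1 (expo_ev H') (expo_ev H).
- move=> y y' /= ee evE; have ee' : e' y = e' y'.
    apply: (expo_inj H ee) => w w' wy wy' ww'.
    have [u [uw uy]] := pb_ex (expo_pb H') wy.
    have [u' [uw' uy']] := pb_ex (expo_pb H') wy'.
    rewrite -uw -uw' -!(expo_ev H') !PV.1; congr (g _).
    by apply: evE; rewrite ?uw ?uw'.
  apply: (expo_inj H' ee') => u u' uy uy' uu'.
  by apply: (pb_inj PV); [rewrite !(expo_ev H')|apply: evE; rewrite ?uu'].
move=> z P [Pz PU].
(* The image under [g] of the given section is a section of [p]. *)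
have [|y [ey yP]] := expo_ex H (z := z) (P := fun a => exists2 a', P a' & g a' = a).
  split=> [_ [a' Pa <-]|x fx]; first exact: Pz.
  have [a' [[Pa pa] aU]] := PU x fx.
  exists (g a'); split=> [|_ [[b Pb <-] pb]]; first by split=> //; exists a'.
  by rewrite (aU b).
(* The given section is now spread over the fibre of [w2] at [y], where it lifts the values of
   [y]. *)
have [|y' [ey' yP']] := expo_ex H' (z := y) (P := fun v => w2 (v1 v) = y /\ P (v2 v)).
  split=> [v []|w wy] //; have [a' Pa ga] := yP w wy.
  have [v [vw va]] := pb_ex PV (esym ga); exists v.
  split=> [|v' [[_ Pv'] vw']]; first by rewrite vw va.
  apply: (pb_inj PV); rewrite ?vw ?vw' // va.
  have [|b [_ bU]] := PU (w1 w); first by rewrite (expo_pb H).1 wy.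
  by rewrite -(bU a') ?(bU (v2 v')) //= -?PV.1 ?vw' ?ga (expo_ev H).
by exists y'; split=> [|u /yP' []] //=; rewrite ey'.
Qed.

(** The fibre of [f' \og f] is the union of the fibres of [f] over a fibre of [f']. A section over
    it is therefore a family of sections over those smaller fibres, which is a section of [e] along
    [f']. Functoriality of norms rests on this. *)
Lemma expo_comp_f A X Z Z' E W E' W' V (p : gmap A X) (f : gmap X Z)
    (e : gmap E Z) (w1 : gmap W X) (w2 : gmap W E) (ev : gmap W A)
    (f' : gmap Z Z') (e' : gmap E' Z') (x1 : gmap W' Z) (x2 : gmap W' E')
    (ev' : gmap W' E) (v1 : gmap V W) (v2 : gmap V W') :
    is_exponential p f e w1 w2 ev -> is_exponential e f' e' x1 x2 ev' ->
    is_pullback w2 ev' v1 v2 ->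
  is_exponential p (f' \og f) e' (w1 \og v1) (x2 \og v2) (ev \og v1).
Proof.
move=> H H' PV; have ee : e \og ev' = x1 by apply: gmap_ext => t; apply: expo_ev H' t.
have ex_v t w : w2 w = ev' t -> exists v, v1 v = w /\ v2 v = t by exact: pb_ex PV _ _.
apply: expoI.
- have := pb_paste (expo_pb H) PV; rewrite ee => /pb_sym P.
  exact/pb_sym/(pb_paste (pb_sym (expo_pb H')) P).
- by move=> v; apply: expo_ev H _.
- move=> y y' ey evE; apply: (expo_inj H' ey) => t t' ty ty' tt'.
  apply: (expo_inj H) => [|w w' wt wt' ww']; first by rewrite !(expo_ev H').
  have [v [vw vt]] := ex_v _ _ wt; have [v' [vw' vt']] := ex_v _ _ wt'.
  by rewrite -vw -vw'; apply: evE; rewrite /= ?vt ?vt' ?vw ?vw'.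
move=> z P [Pz PU].
(* The points of [E] which are pieces of the section [P], cut out by one fibre of [f]. *)
pose P' y := f' (e y) = z /\ forall w, w2 w = y -> P (ev w).
have [|y [ey yP]] := expo_ex H' (z := z) (P := P').
  split=> [y []|z1 fz] //.
  have [|y [ey yP]] := expo_ex H (z := z1) (P := fun a => f (p a) = z1 /\ P a).
    split=> [a []|x fx] //.
    have [|a [[Pa pa] aU]] := PU x; first by rewrite /= fx.
    by exists a; split=> [|b [[_ Pb] pb]]; [by rewrite pa|apply: aU].
  exists y; split=> [|y' [[_ y'P] ey']].
    by split=> //; split=> [|w /yP []] //; rewrite ey.
  apply: (expo_inj H); rewrite ?ey // => w w' wy wy' ww'.
  have [|a [_ aU]] := PU (w1 w); first by rewrite /= (expo_pb H).1 wy ey.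
  have [_ Pw] := yP _ wy; have Pw' := y'P _ wy'.
  by rewrite -(aU (ev w)) ?(aU (ev w')) // (expo_ev H).
exists y; split=> // v /= vy; have [_] := yP _ vy; apply.
exact: PV.1.
Qed.

(** The fibre of [q] at [y] is carried bijectively by [x] to the fibre of [f] at [h y], so both have
    the same sections. This gives the Mackey formula for norms. *)
Lemma expo_bc A X Z E W Y X' A' E' W' (p : gmap A X) (f : gmap X Z)
    (e : gmap E Z) (w1 : gmap W X) (w2 : gmap W E) (ev : gmap W A)
    (h : gmap Y Z) (x : gmap X' X) (q : gmap X' Y) (a : gmap A' A) (p' : gmap A' X')
    (n : gmap E' E) (e' : gmap E' Y) (o : gmap W' W) (w2' : gmap W' E')
    (w1' : gmap W' X') (ev' : gmap W' A') :
    is_exponential p f e w1 w2 ev ->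
    is_pullback f h x q -> is_pullback p x a p' -> is_pullback e h n e' ->
    is_pullback w2 n o w2' ->
    (forall w, x (w1' w) = w1 (o w)) -> (forall w, q (w1' w) = e' (w2' w)) ->
    (forall w, a (ev' w) = ev (o w)) -> (forall w, p' (ev' w) = w1' w) ->
  is_exponential p' q e' w1' w2' ev'.
Proof.
move=> H PX PA PE PW xw qw av pv; apply: expoI => //.
- apply: pbI => // [w w' ww ww'|x' y qx].
    apply: (pb_inj PW) => //; apply: (pb_inj (expo_pb H)); rewrite -?xw ?ww //.
    by rewrite !PW.1 ww'.
  have [|w [wx wy]] := @pb_ex _ _ _ _ _ _ _ _ (expo_pb H) (x x') (n y).
    by rewrite PX.1 PE.1 qx.
  have [w' [ww wy']] := pb_ex PW wy; exists w'; split=> //.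
  by apply: (pb_inj PX); rewrite ?xw ?ww ?qw ?wy'.
- move=> y y' ey evE; apply: (pb_inj PE) => //.
  apply: (expo_inj H) => [|w w' wy wy' ww']; first by rewrite !PE.1 ey.
  have [v [vw vy]] := pb_ex PW wy; have [v' [vw' vy']] := pb_ex PW wy'.
  rewrite -vw -vw' -!av; congr (a _); apply: evE => //.
  by apply: (pb_inj PX); rewrite ?xw ?vw ?vw' // !qw vy vy'.
move=> y0 P [Py PU].
(* The section over [y0] is pushed forward along [a] to a section over [h y0], and the resulting
   point is pulled back to [E']. *)
have [|y [ey yP]] := expo_ex H (z := h y0) (P := fun b => exists2 b', P b' & a b' = b).
  split=> [_ [b' Pb <-]|x0 fx]; first by rewrite PA.1 PX.1 Py.
  have [x' [xx qx]] := pb_ex PX fx; have [b [[Pb pb] bU]] := PU x' qx.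
  exists (a b); split=> [|_ [[b' Pb' <-] pb']].
    by split; [exists b|rewrite PA.1 pb].
  congr (a _); apply: bU; split=> //; apply: (pb_inj PX); last by rewrite Py.
  by rewrite xx -PA.1.
have [y' [ny ey']] := pb_ex PE ey; exists y'; split=> // w wy.
have [|b Pb ab] := yP (o w); first by rewrite PW.1 wy.
suff -> : ev' w = b by [].
apply: (pb_inj PA); first by rewrite av.
rewrite pv; apply: (pb_inj PX); last by rewrite qw wy Py.
by rewrite xw -(expo_ev H) -ab PA.1.
Qed.

Lemma expo_id X Z (f : gmap X Z) : is_exponential gmap_id f gmap_id gmap_id f gmap_id.
Proof.
apply: expoI => //=; first exact: pb_id.
move=> z P [Pz PU]; exists z; split=> // x fx.
by have [a [[Pa <-] _]] := PU x fx.
Qed.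

Lemma expo_along_id A X (p : gmap A X) : is_exponential p gmap_id p p gmap_id gmap_id.
Proof.
apply: expoI => //=; first exact/pb_sym/pb_id.
  by move=> y y' py; apply.
move=> x P [Px PU]; have [a [[Pa pa] _]] := PU x erefl.
by exists a; split=> // _ ->.
Qed.

(* Distributivity: a section of Y + X -> X + X over the fold is a point of Y. *)
Lemma expo_fold X Y (f : gmap Y X) :
  is_exponential (gplus f gmap_id) (gfold X) f (gplus f f) (gfold Y) (gplus gmap_id f).
Proof.
apply: expoI; first exact: pb_fold.
- by case.
- move=> y y' fy evE.
  by have /= [] := evE (inl y) (inl y') erefl erefl (congr1 inl fy).
move=> x P [Px PU].
have [a [[Pa]]] := PU (inl x) erefl; case: a Pa => [y|x'] //= Py [py] _.
have [a [[Pa]]] := PU (inr x) erefl; case: a Pa => [y'|x'] //= Px' [px'] _.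
by exists y; split=> // -[y'|y'] /= ->; rewrite // py -px'.
Qed.

End GSets.

(** * Consequences of the Mackey axioms, shared by transfers and norms *)

Section SemiMackey.

Variables (gT : finGroupType) (V : gset gT -> Type).
Variable res : forall X Y, gmap X Y -> V Y -> V X.
Variable tr : forall X Y, gmap X Y -> V X -> V Y.
Hypothesis H : semi_mackey res tr.
Implicit Types X Y Z : gset gT.

Lemma sm_res_eq X Y Z (f : gmap Y Z) (h : gmap X Y) (g : gmap X Z) a :
  f \og h = g -> res h (res f a) = res g a.
Proof. by move=> <-; rewrite (sm_res_comp H). Qed.

Lemma sm_tr_eq X Y Z (f : gmap Y Z) (h : gmap X Y) (g : gmap X Z) a :
  f \og h = g -> tr f (tr h a) = tr g a.
Proof. by move=> <-; rewrite (sm_tr_comp H). Qed.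

Lemma sm_mono X Y (f : gmap X Y) a : injective f -> res f (tr f a) = a.
Proof.
by move=> fi; rewrite (sm_pullback H (pb_mono fi)) (sm_res_id H) (sm_tr_id H).
Qed.

Lemma sm_res_iso X Y (f : gmap X Y) (h : gmap Y X) a :
  cancel f h -> cancel h f -> res f a = tr h a.
Proof.
move=> fK hK; rewrite -{1}(sm_tr_id H a).
by rewrite (sm_pullback H (pb_iso fK hK)) (sm_res_id H).
Qed.

Lemma sm_tr_res_iso X Y (f : gmap X Y) (h : gmap Y X) a :
  cancel f h -> cancel h f -> tr f (res f a) = a.
Proof.
move=> fK hK; rewrite (sm_res_iso _ fK hK) -(sm_tr_comp H).
by rewrite (_ : f \og h = gmap_id) ?(sm_tr_id H) //; apply: gmap_ext.
Qed.

Lemma sm_glue_ex X Y (a : V X) (b : V Y) :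
  exists c, res (gl X Y) c = a /\ res (gr X Y) c = b.
Proof. by have [c [cP _]] := sm_coproduct H (gsumP X Y) a b; exists c. Qed.

Definition sm_glue X Y (a : V X) (b : V Y) : V (gsum X Y) := sval (cid (sm_glue_ex a b)).

Lemma sm_gluel X Y (a : V X) (b : V Y) : res (gl X Y) (sm_glue a b) = a.
Proof. by rewrite /sm_glue; case: cid => c []. Qed.

Lemma sm_gluer X Y (a : V X) (b : V Y) : res (gr X Y) (sm_glue a b) = b.
Proof. by rewrite /sm_glue; case: cid => c []. Qed.

Lemma sm_inj X Y (c c' : V (gsum X Y)) :
  res (gl X Y) c = res (gl X Y) c' -> res (gr X Y) c = res (gr X Y) c' -> c = c'.
Proof.
move=> cl cr.
have [d [_ dU]] := sm_coproduct H (gsumP X Y) (res (gl X Y) c') (res (gr X Y) c').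
by rewrite -(dU c) // (dU c').
Qed.

Lemma sm_glueE X Y (a : V X) (b : V Y) c :
  res (gl X Y) c = a -> res (gr X Y) c = b -> c = sm_glue a b.
Proof. by move=> ca cb; apply: sm_inj; rewrite ?sm_gluel ?sm_gluer. Qed.

Lemma sm_tr_glue X Y X' Y' (f : gmap X X') (h : gmap Y Y') a b :
  tr (gplus f h) (sm_glue a b) = sm_glue (tr f a) (tr h b).
Proof.
apply: sm_glueE.
  by rewrite (sm_pullback H (pb_plusl f h)) sm_gluel.
by rewrite (sm_pullback H (pb_plusr f h)) sm_gluer.
Qed.

Lemma sm_res_glue X Y X' Y' (f : gmap X X') (h : gmap Y Y') a b :
  res (gplus f h) (sm_glue a b) = sm_glue (res f a) (res h b).
Proof.
apply: sm_glueE.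
  by rewrite -{2}(sm_gluel a b) -!(sm_res_comp H); congr res; apply: gmap_ext.
by rewrite -{2}(sm_gluer a b) -!(sm_res_comp H); congr res; apply: gmap_ext.
Qed.

(* For (res, tr) this is the sum of a Tambara functor, for (res, nm) its product. *)
Definition sm_op X (a b : V X) : V X := tr (gfold X) (sm_glue a b).

Lemma sm_opC X : commutative (@sm_op X).
Proof.
move=> a b; pose s : gmap (gsum X X) (gsum X X) := gcase (gr X X) (gl X X).
have sK : cancel s s by case.
rewrite /sm_op; have <- : res s (sm_glue a b) = sm_glue b a.
  apply: sm_glueE; rewrite -(sm_res_comp H).
    by rewrite -{2}(sm_gluer a b); congr res; apply: gmap_ext.
  by rewrite -{2}(sm_gluel a b); congr res; apply: gmap_ext.
rewrite (sm_res_iso _ sK sK) -(sm_tr_comp H); congr (tr _ _).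
by apply: gmap_ext => -[].
Qed.

Lemma sm_opA X : associative (@sm_op X).
Proof.
move=> a b c; rewrite /sm_op.
have -> : sm_glue a (tr (gfold X) (sm_glue b c)) =
    tr (gplus gmap_id (gfold X)) (sm_glue a (sm_glue b c)).
  by rewrite sm_tr_glue (sm_tr_id H).
have -> : sm_glue (tr (gfold X) (sm_glue a b)) c =
    tr (gplus (gfold X) gmap_id) (sm_glue (sm_glue a b) c).
  by rewrite sm_tr_glue (sm_tr_id H).
(* The two bracketings of a triple disjoint union are exchanged by the mutually inverse maps [s] and
   [t]. Both iterated fold maps agree through them. *)
pose s : gmap (gsum X (gsum X X)) (gsum (gsum X X) X) :=
  gcase (gl _ _ \og gl _ _) (gcase (gl _ _ \og gr _ _) (gr _ _)).
pose t : gmap (gsum (gsum X X) X) (gsum X (gsum X X)) :=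
  gcase (gcase (gl _ _) (gr _ _ \og gl _ _)) (gr _ _ \og gr _ _).
have st : cancel s t by case=> [|[]].
have ts : cancel t s by case=> [[]|].
have -> : sm_glue a (sm_glue b c) = res s (sm_glue (sm_glue a b) c).
  symmetry; apply: sm_glueE.
    rewrite -{2}(sm_gluel a b) -{2}(sm_gluel (sm_glue a b) c) -!(sm_res_comp H).
    by congr res; apply: gmap_ext.
  apply: sm_glueE.
    rewrite -{2}(sm_gluer a b) -{2}(sm_gluel (sm_glue a b) c) -!(sm_res_comp H).
    by congr res; apply: gmap_ext.
  rewrite -{2}(sm_gluer (sm_glue a b) c) -!(sm_res_comp H).
  by congr res; apply: gmap_ext.
rewrite (sm_res_iso _ st ts) -!(sm_tr_comp H); congr (tr _ _).
by apply: gmap_ext => -[[]|].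
Qed.

(** The level of the empty set has a single element, so any [z] will serve. It is 0 when the
    structure map is a transfer and 1 when it is a norm. *)
Lemma sm_op_unit X (z : V (gvoid gT)) (a : V X) : sm_op (tr (from_void X) z) a = a.
Proof.
rewrite /sm_op -{1}(sm_tr_id H a) -sm_tr_glue -(sm_tr_comp H).
have -> : sm_glue z a = tr (gr (gvoid gT) X) a.
  symmetry; apply: sm_glueE; first by apply: (sm_empty H); case.
  exact: sm_mono (@gr_inj _ _ _).
by rewrite -(sm_tr_comp H) -{2}(sm_tr_id H a); congr (tr _ _); apply: gmap_ext.
Qed.

Lemma sm_op_tr X Y (f : gmap X Y) a b : tr f (sm_op a b) = sm_op (tr f a) (tr f b).
Proof.
rewrite /sm_op -sm_tr_glue -!(sm_tr_comp H); congr (tr _ _).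
by apply: gmap_ext => -[].
Qed.

Lemma sm_op_res X Y (f : gmap X Y) a b : res f (sm_op a b) = sm_op (res f a) (res f b).
Proof. by rewrite /sm_op (sm_pullback H (pb_fold f)) sm_res_glue. Qed.

Lemma sm_void_tr X Y (f : gmap X Y) z :
  tr f (tr (from_void X) z) = tr (from_void Y) z.
Proof. by rewrite -(sm_tr_comp H); congr tr; apply: gmap_ext; case. Qed.

Lemma sm_void_res X Y (f : gmap X Y) z :
  res f (tr (from_void Y) z) = tr (from_void X) z.
Proof.
have P : is_pullback (from_void Y) f gmap_id (from_void X) by apply: pbI => [[]|[]|[]].
by rewrite (sm_pullback H P) (sm_res_id H).
Qed.

End SemiMackey.

(** * Elements of a module over a disjoint union *)

Section ModuleGlue.

Variables (gT : finGroupType) (k : tambara gT) (M : kmodule k).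
Implicit Types X Y Z : gset gT.

(** The element with restrictions [a] and [b]. Unlike [sm_glue], which is chosen by the coproduct
    axiom, it is given by a formula through which morphisms pass at once. *)
Definition mcat X Y (a : M X) (b : M Y) : M (gsum X Y) :=
  mtr M (gl X Y) a + mtr M (gr X Y) b.

Lemma m_void_tr X Y (f : gmap X Y) a : (X -> False) -> mtr M f a = 0.
Proof. by move=> X0; rewrite (sm_empty (m_mackey M) X0 a 0) raddf0. Qed.

Lemma m_disjoint X Y Z (f : gmap X Z) (h : gmap Y Z) a :
  (forall x y, f x <> h y) -> mres M h (mtr M f a) = 0.
Proof.
by move=> fh; rewrite (sm_pullback (m_mackey M) (pb_void fh)) m_void_tr //; case.
Qed.

Lemma mcatl X Y (a : M X) (b : M Y) : mres M (gl X Y) (mcat a b) = a.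
Proof.
by rewrite raddfD /= (sm_mono (m_mackey M) _ (@gl_inj _ _ _)) m_disjoint ?addr0.
Qed.

Lemma mcatr X Y (a : M X) (b : M Y) : mres M (gr X Y) (mcat a b) = b.
Proof.
by rewrite raddfD /= (sm_mono (m_mackey M) _ (@gr_inj _ _ _)) m_disjoint ?add0r.
Qed.

Lemma mcatE X Y (a : M X) (b : M Y) c :
  mres M (gl X Y) c = a -> mres M (gr X Y) c = b -> c = mcat a b.
Proof. by move=> ca cb; apply: (sm_inj (m_mackey M)); rewrite ?mcatl ?mcatr. Qed.

Lemma m_case X Y Z (f : gmap X Z) (h : gmap Y Z) a b :
  mtr M (gcase f h) (mcat a b) = mtr M f a + mtr M h b.
Proof.
rewrite raddfD /=.
by congr (_ + _); apply: (sm_tr_eq (m_mackey M)); apply: gmap_ext.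
Qed.

Lemma m_res_case X Y Z (f : gmap X Z) (h : gmap Y Z) c :
  mres M (gcase f h) c = mcat (mres M f c) (mres M h c).
Proof.
by apply: mcatE; apply: (sm_res_eq (m_mackey M)); apply: gmap_ext.
Qed.

Lemma mtr_plus X Y X' Y' (f : gmap X X') (h : gmap Y Y') a b :
  mtr M (gplus f h) (mcat a b) = mcat (mtr M f a) (mtr M h b).
Proof. by rewrite m_case !(sm_tr_comp (m_mackey M)). Qed.

Lemma mres_plus X Y X' Y' (f : gmap X X') (h : gmap Y Y') a b :
  mres M (gplus f h) (mcat a b) = mcat (mres M f a) (mres M h b).
Proof. by rewrite m_res_case !(sm_res_comp (m_mackey M)) mcatl mcatr. Qed.

End ModuleGlue.

(** * A small skeleton of the finite G-sets *)

Section Codes.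

Variable gT : finGroupType.

(* Finite G-sets on the ordinals form a small skeleton: the carriers built
   below quantify over it, since quantifying over all of [gset gT] would put
   them one universe too high. *)
Definition code : Type := {n : nat & {action gT &-> 'I_n}}.

Definition el (c : code) : gset gT := GSet (projT2 c).

Section CodeOf.

Variable X : gset gT.

Definition code_act (i : 'I_#|X|) (g : gT) : 'I_#|X| :=
  enum_rank (gset_act X (enum_val i) g).

Lemma code_act1 : code_act^~ 1%g =1 id.
Proof. by move=> i; rewrite /code_act act1 enum_valK. Qed.

Lemma code_actM i : act_morph code_act i.
Proof. by move=> g h; rewrite /code_act actM enum_rankK. Qed.

Definition cd : code := existT _ #|X| (TotalAction code_act1 code_actM).

Lemma to_cd_equiv (x : X) g :
  enum_rank (gset_act X x g) = gset_act (el cd) (enum_rank x) g.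
Proof. by rewrite /= /code_act enum_rankK. Qed.

Definition to_cd : gmap X (el cd) :=
  @GMap _ X (el cd) (fun x => enum_rank x) to_cd_equiv.

Lemma of_cd_equiv (i : el cd) g :
  enum_val (gset_act (el cd) i g) = gset_act X (enum_val i) g.
Proof. by rewrite /= /code_act enum_rankK. Qed.

Definition of_cd : gmap (el cd) X :=
  @GMap _ (el cd) X (fun i => enum_val i) of_cd_equiv.

Lemma to_cdK : cancel to_cd of_cd. Proof. exact: enum_rankK. Qed.
Lemma of_cdK : cancel of_cd to_cd. Proof. exact: enum_valK. Qed.

End CodeOf.

End Codes.

Arguments to_cd : simpl never.
Arguments of_cd : simpl never.

(** * The quotient of triples and its universal property *)

Section Coend.

Variables (gT : finGroupType) (k : tambara gT) (M N : kmodule k).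
Implicit Types X Y Z : gset gT.

Record coend_pre X := Pre {
  pc : code gT; pf : gmap (el pc) X; pm : M (el pc); pn : N (el pc) }.
Arguments Pre {X pc}.

Inductive coend_step X : coend_pre X -> coend_pre X -> Prop :=
| StepL c d (f : gmap (el d) X) (g : gmap (el c) (el d)) m n :
    coend_step (Pre (f \og g) m (mres N g n)) (Pre f (mtr M g m) n)
| StepR c d (f : gmap (el d) X) (g : gmap (el c) (el d)) m n :
    coend_step (Pre (f \og g) (mres M g m) n) (Pre f m (mtr N g n))
| StepZ c (f : gmap (el c) X) a m n : coend_step (Pre f (a *: m) n) (Pre f m (a *: n)).

(* The equivalence relation generated by [coend_step]: equality under every
   invariant predicate. *)
Definition coend_rel X (p q : coend_pre X) : Prop := forall F : coend_pre X -> Prop,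
  (forall u v, coend_step u v -> F u <-> F v) -> F p <-> F q.

Definition coend X : Type := {P : coend_pre X -> Prop | exists p, P = @coend_rel X p}.

HB.instance Definition _ X := gen_eqMixin (coend X).
HB.instance Definition _ X := gen_choiceMixin (coend X).

Definition cls X (p : coend_pre X) : coend X := exist _ (@coend_rel X p) (ex_intro _ p erefl).

Lemma cls_eq X (p q : coend_pre X) : coend_rel p q -> cls p = cls q.
Proof.
move=> pq; suff E : @coend_rel X p = @coend_rel X q by apply: eq_exist.
apply: funext => r; apply: propext; split=> H F FP; have := pq F FP; have := H F FP; tauto.
Qed.

(** The class of a triple on an arbitrary G-set [Y], moved to the code of [Y]. The rest of the proof
    never mentions codes again. *)
Definition cmk X Y (f : gmap Y X) (m : M Y) (n : N Y) : coend X :=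
  cls (Pre (f \og of_cd Y) (mres M (of_cd Y) m) (mres N (of_cd Y) n)).

Section Lift.

Variables (X : gset gT) (Z : Type) (phi : forall Y, gmap Y X -> M Y -> N Y -> Z).

(** The three relations, imposed for all finite G-sets and not only for codes. The target [Z] is a
    bare type, so that sums, scalars and norms are all defined by the same descent. *)
Record balanced : Prop := Balanced {
  balL : forall Y Y' (f : gmap Y X) (g : gmap Y' Y) m n,
    phi (f \og g) m (mres N g n) = phi f (mtr M g m) n;
  balR : forall Y Y' (f : gmap Y X) (g : gmap Y' Y) m n,
    phi (f \og g) (mres M g m) n = phi f m (mtr N g n);
  balZ : forall Y (f : gmap Y X) a m n, phi f (a *: m) n = phi f m (a *: n) }.

Hypothesis B : balanced.

Lemma bal_iso Y Y' (f : gmap Y X) (g : gmap Y' Y) (h : gmap Y Y') m n :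
  cancel g h -> cancel h g ->
  phi (f \og g) (mres M g m) (mres N g n) = phi f m n.
Proof. by move=> gK hK; rewrite balL // (sm_tr_res_iso (m_mackey M) _ gK hK). Qed.

Definition clift (c : coend X) : Z := let p := cid (svalP c) in
  phi (pf (sval p)) (pm (sval p)) (pn (sval p)).

Lemma cliftE Y (f : gmap Y X) m n : clift (cmk f m n) = phi f m n.
Proof.
rewrite /clift; case: cid => p /= E.
have <- := bal_iso f m n (@of_cdK _ Y) (@to_cdK _ Y).
(* The invariant predicate that makes the chosen representative [p] irrelevant: having the same
   value of [phi] as [p]. *)
pose F (q : coend_pre X) := phi (pf p) (pm p) (pn p) = phi (pf q) (pm q) (pn q).
have Fstep u v : coend_step u v -> F u <-> F v.
  by rewrite /F; case=> *; rewrite /= (balL B, balR B, balZ B).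
have : coend_rel p p by [].
by rewrite -E => /(_ F Fstep) [_]; apply.
Qed.

End Lift.

(** The generating relations hold for codes. The pullback square [sqr] replaces [g] by the map that
    it induces on codes, and the Mackey formula carries the transfer along [g] across it. *)
Lemma mk_bal X : balanced (fun Y f m n => @cmk X Y f m n).
Proof.
have cls_step (u v : coend_pre X) : coend_step u v -> cls u = cls v.
  by move=> uv; apply: cls_eq => F; apply.
have sqr Y Y' (g : gmap Y' Y) : is_pullback g (of_cd Y) (of_cd Y') (to_cd Y \og g \og of_cd Y').
  apply: pbI => [w|w w' /(can_inj (@of_cdK _ _)) //|x y gx]; first exact/esym/to_cdK.
  exists (to_cd _ x); split; first exact: to_cdK.
  by rewrite -(of_cdK y) -gx; congr (to_cd Y (g _)); apply: to_cdK.
have sqE Y Y' (g : gmap Y' Y) : of_cd Y \og (to_cd Y \og g \og of_cd Y') = g \og of_cd Y'.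
  by apply: gmap_ext => x; apply: to_cdK.
have sqf Y Y' (f : gmap Y X) (g : gmap Y' Y) :
    f \og of_cd Y \og (to_cd Y \og g \og of_cd Y') = f \og g \og of_cd Y'.
  by apply: gmap_ext => x; congr (f _); apply: to_cdK.
split=> [Y Y' f g m n|Y Y' f g m n|Y f a m n]; rewrite /cmk.
- rewrite (sm_pullback (m_mackey M) (sqr _ _ g)) -(cls_step _ _ (StepL _ _ _ _)).
  by rewrite sqf (sm_res_eq (m_mackey N) _ (sqE _ _ _)) (sm_res_comp (m_mackey N)).
- rewrite (sm_pullback (m_mackey N) (sqr _ _ g)) -(cls_step _ _ (StepR _ _ _ _)).
  by rewrite sqf (sm_res_eq (m_mackey M) _ (sqE _ _ _)) (sm_res_comp (m_mackey M)).
by rewrite !mresZ; apply/cls_step/StepZ.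
Qed.

Lemma mkL X Y Y' (f : gmap Y X) (g : gmap Y' Y) m n :
  cmk (f \og g) m (mres N g n) = cmk f (mtr M g m) n.
Proof. exact: (balL (mk_bal X)). Qed.

Lemma mkR X Y Y' (f : gmap Y X) (g : gmap Y' Y) m n :
  cmk (f \og g) (mres M g m) n = cmk f m (mtr N g n).
Proof. exact: (balR (mk_bal X)). Qed.

Lemma mkZ X Y (f : gmap Y X) a m n : cmk f (a *: m) n = cmk f m (a *: n).
Proof. exact: (balZ (mk_bal X)). Qed.

Lemma mk_iso X Y Y' (f : gmap Y X) (f' : gmap Y' X) (g : gmap Y' Y) (h : gmap Y Y') m n :
  cancel g h -> cancel h g -> f \og g = f' ->
  cmk f' (mres M g m) (mres N g n) = cmk f m n.
Proof. by move=> gK hK <-; apply: (bal_iso (mk_bal X)) gK hK. Qed.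

Lemma mkP X (c : coend X) : exists Y (f : gmap Y X) m n, c = cmk f m n.
Proof.
case: c => P [[c f m n] E]; subst P; exists (el c), f, m, n.
rewrite (_ : exist _ _ _ = cls (Pre f m n)); last exact: eq_exist.
apply/esym/cls_eq => F FS; rewrite (FS _ _ (StepL _ _ _ _)).
by rewrite (sm_tr_res_iso (m_mackey M) _ (@of_cdK _ _) (@to_cdK _ _)).
Qed.

End Coend.

(** * The coend of two modules as a module *)

Section CoendModule.

Variables (gT : finGroupType) (k : tambara gT) (M N : kmodule k).
Implicit Types X Y Z : gset gT.
Local Notation mk := (@cmk _ k M N _ _).
Local Notation coend := (coend M N).

Lemma mk_swap X Y Y' (f : gmap Y X) (f' : gmap Y' X) m m' n n' :
  mk (gcase f f') (mcat m m') (mcat n n') = mk (gcase f' f) (mcat m' m) (mcat n' n).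
Proof.
pose s Y Y' : gmap (gsum Y Y') (gsum Y' Y) := gcase (gr Y' Y) (gl Y' Y).
have sK Z Z' : cancel (s Z Z') (s Z' Z) by case.
rewrite -(mk_iso (mcat m' m) (mcat n' n) (sK Y Y') (sK Y' Y) erefl).
rewrite /s !m_res_case !mcatl !mcatr; congr mk.
by apply: gmap_ext => -[].
Qed.

Lemma mk_case_bal X Y' (f' : gmap Y' X) m' n' :
  balanced (fun Y (f : gmap Y X) (m : M Y) (n : N Y) =>
    mk (gcase f f') (mcat m m') (mcat n n')).
Proof.
have E Y Y1 (f : gmap Y X) (g : gmap Y1 Y) : gcase (f \og g) f' = gcase f f' \og gplus g gmap_id.
  by apply: gmap_ext => -[].
split=> [Y Y1 f g m n|Y Y1 f g m n|Y f a m n]; rewrite ?E.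
- rewrite -[n' in LHS](sm_res_id (m_mackey N)) -mres_plus mkL mtr_plus.
  by rewrite (sm_tr_id (m_mackey M)).
- rewrite -[m' in LHS](sm_res_id (m_mackey M)) -mres_plus mkR mtr_plus.
  by rewrite (sm_tr_id (m_mackey N)).
(* The scalar acts on the first summand only. Extended by 1 on the second, it becomes a scalar on
   the disjoint union and can change sides there. *)
pose b : k (gsum Y Y') := sm_glue (res_tr_mackey k) a 1.
have bE (L : kmodule k) (u : L Y) (v : L Y') : mcat (a *: u) v = b *: mcat u v.
  symmetry; apply: mcatE; rewrite mresZ ?mcatl ?mcatr.
    by rewrite (sm_gluel (res_tr_mackey k)).
  by rewrite (sm_gluer (res_tr_mackey k)) scale1r.
by rewrite !bE mkZ.
Qed.

Definition cadd X (c c' : coend X) : coend X :=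
  clift (fun Y' (f' : gmap Y' X) (m' : M Y') (n' : N Y') =>
    clift (fun Y (f : gmap Y X) (m : M Y) (n : N Y) =>
      mk (gcase f f') (mcat m m') (mcat n n')) c) c'.

(** Exchanging the two summands reduces this to balancedness in the first variable. *)
Lemma cadd_bal X (c : coend X) :
  balanced (fun Y' (f' : gmap Y' X) (m' : M Y') (n' : N Y') =>
    clift (fun Y (f : gmap Y X) (m : M Y) (n : N Y) =>
      mk (gcase f f') (mcat m m') (mcat n n')) c).
Proof.
have [Y0 [f0 [m0 [n0 ->]]]] := mkP c.
have B := mk_case_bal f0 m0 n0.
split=> [Y Y' f g m n|Y Y' f g m n|Y f a m n];
  rewrite !(cliftE (mk_case_bal _ _ _)).
- by rewrite mk_swap [RHS]mk_swap (balL B).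
- by rewrite mk_swap [RHS]mk_swap (balR B).
- by rewrite mk_swap [RHS]mk_swap (balZ B).
Qed.

Lemma caddE X Y Y' (f : gmap Y X) (f' : gmap Y' X) m m' n n' :
  cadd (mk f m n) (mk f' m' n') = mk (gcase f f') (mcat m m') (mcat n n').
Proof. by rewrite /cadd (cliftE (cadd_bal _)) (cliftE (mk_case_bal _ _ _)). Qed.

(** Frobenius reciprocity for the fold map: [m + m'] is the transfer of [mcat m m'], while [n]
    restricts to [mcat n n]. *)
Lemma mk_addl X Y (f : gmap Y X) m m' n : mk f (m + m') n = cadd (mk f m n) (mk f m' n).
Proof.
rewrite caddE -{2 3}(sm_res_id (m_mackey N) n) -m_res_case.
have -> : gcase f f = f \og gfold Y by apply: gmap_ext => -[].
by rewrite mkL m_case !(sm_tr_id (m_mackey M)).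
Qed.

Lemma mk_addr X Y (f : gmap Y X) m n n' : mk f m (n + n') = cadd (mk f m n) (mk f m n').
Proof.
rewrite caddE -{2 3}(sm_res_id (m_mackey M) m) -m_res_case.
have -> : gcase f f = f \og gfold Y by apply: gmap_ext => -[].
by rewrite mkR m_case !(sm_tr_id (m_mackey N)).
Qed.

Definition czero X : coend X := mk (from_void X) 0 0.

Lemma mk_void X Y (f : gmap Y X) m n : (Y -> False) -> mk f m n = czero X.
Proof.
move=> Y0; have [h hK] : exists h : gmap Y (gvoid gT),
    cancel (from_void Y) h /\ cancel h (from_void Y).
  by apply: gmap_bij => [[]|y]; case: (Y0 y).
rewrite -(mk_iso m n hK.1 hK.2 erefl) /czero; congr mk.
- by apply: gmap_ext; case.
- by apply: (sm_empty (m_mackey M)); case.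
- by apply: (sm_empty (m_mackey N)); case.
Qed.

Lemma mk0l X Y (f : gmap Y X) n : mk f 0 n = czero X.
Proof. by rewrite -(raddf0 (mtr M (from_void Y))) -mkL mk_void //; case. Qed.

Definition copp X (c : coend X) : coend X :=
  clift (fun Y (f : gmap Y X) m n => mk f (- m) n) c.

Lemma copp_bal X : balanced (fun Y (f : gmap Y X) (m : M Y) (n : N Y) => mk f (- m) n).
Proof.
split=> [Y Y' f g m n|Y Y' f g m n|Y f a m n]; first by rewrite -raddfN mkL.
  by rewrite -raddfN mkR.
by rewrite -scalerN mkZ.
Qed.

Lemma coppE X Y (f : gmap Y X) m n : copp (mk f m n) = mk f (- m) n.
Proof. exact: (cliftE (copp_bal X)). Qed.

Lemma caddC X : commutative (@cadd X).
Proof.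
move=> c c'; have [Y [f [m [n ->]]]] := mkP c; have [Y' [f' [m' [n' ->]]]] := mkP c'.
by rewrite !caddE mk_swap.
Qed.

Lemma caddA X : associative (@cadd X).
Proof.
move=> c c' c''; have [Y [f [m [n ->]]]] := mkP c.
have [Y' [f' [m' [n' ->]]]] := mkP c'; have [Y'' [f'' [m'' [n'' ->]]]] := mkP c''.
rewrite !caddE.
pose s : gmap (gsum Y (gsum Y' Y'')) (gsum (gsum Y Y') Y'') :=
  gcase (gl _ _ \og gl _ _) (gcase (gl _ _ \og gr _ _) (gr _ _)).
pose t : gmap (gsum (gsum Y Y') Y'') (gsum Y (gsum Y' Y'')) :=
  gcase (gcase (gl _ _) (gr _ _ \og gl _ _)) (gr _ _ \og gr _ _).
have st : cancel s t by case=> [|[]].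
have ts : cancel t s by case=> [[]|].
rewrite -(mk_iso _ _ st ts erefl) /s !m_res_case.
rewrite !(sm_res_comp (m_mackey _)) !(mcatl, mcatr); congr mk.
by apply: gmap_ext => -[|[]].
Qed.

Lemma cadd0 X : left_id (czero X) (@cadd X).
Proof.
move=> c; have [Y [f [m [n ->]]]] := mkP c; rewrite caddE.
have [h hK] : exists h : gmap (gsum (gvoid gT) Y) Y,
    cancel (gr (gvoid gT) Y) h /\ cancel h (gr (gvoid gT) Y).
  by apply: gmap_bij => [|[[]|y]]; [exact: gr_inj|exists y].
rewrite -(mk_iso _ _ hK.1 hK.2 erefl) !mcatr; congr mk.
exact: gmap_ext.
Qed.

Lemma caddN X : left_inverse (czero X) (@copp X) (@cadd X).
Proof.
move=> c; have [Y [f [m [n ->]]]] := mkP c.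
by rewrite coppE -mk_addl addNr mk0l.
Qed.

HB.instance Definition _ X :=
  GRing.isZmodule.Build (coend X) (@caddA X) (@caddC X) (@cadd0 X) (@caddN X).

Lemma mk_add X Y Y' (f : gmap Y X) (f' : gmap Y' X) m m' n n' :
  mk f m n + mk f' m' n' = mk (gcase f f') (mcat m m') (mcat n n').
Proof. exact: caddE. Qed.

Lemma mkDl X Y (f : gmap Y X) m m' n : mk f (m + m') n = mk f m n + mk f m' n.
Proof. exact: mk_addl. Qed.

Lemma mkDr X Y (f : gmap Y X) m n n' : mk f m (n + n') = mk f m n + mk f m n'.
Proof. exact: mk_addr. Qed.

Lemma mk_empty X Y (f : gmap Y X) m n : (Y -> False) -> mk f m n = 0.
Proof. exact: mk_void. Qed.

Definition ctr X Y (h : gmap X Y) (c : coend X) : coend Y :=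
  clift (fun Z (f : gmap Z X) m n => mk (h \og f) m n) c.

Lemma ctr_bal X Y (h : gmap X Y) :
  balanced (fun Z (f : gmap Z X) (m : M Z) (n : N Z) => mk (h \og f) m n).
Proof.
by split=> *; rewrite ?gmap_compA ?mkL ?mkR ?mkZ.
Qed.

Lemma ctrE X Y (h : gmap X Y) Z (f : gmap Z X) m n : ctr h (mk f m n) = mk (h \og f) m n.
Proof. exact: (cliftE (ctr_bal h)). Qed.

Definition cres X Y (h : gmap X Y) (c : coend Y) : coend X :=
  clift (fun Z (f : gmap Z Y) m n =>
    mk (pbk2 f h) (mres M (pbk1 f h) m) (mres N (pbk1 f h) n)) c.

Lemma mk_pb_eq X Y Z W W' (f : gmap Z Y) (h : gmap X Y) (p : gmap W Z) (q : gmap W X)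
    (p' : gmap W' Z) (q' : gmap W' X) m n :
    is_pullback f h p q -> is_pullback f h p' q' ->
  mk q (mres M p m) (mres N p n) = mk q' (mres M p' m) (mres N p' n).
Proof.
move=> P P'; have [t [t1 t2]] := pb_map P' P.1.
have [t' [t1' t2']] := pb_map P P'.1.
have tt' : cancel t t' by move=> w; apply: (pb_inj P); rewrite ?t1' ?t2' ?t1 ?t2.
have t't : cancel t' t by move=> w; apply: (pb_inj P'); rewrite ?t1 ?t2 ?t1' ?t2'.
have pt : p' \og t = p by apply: gmap_ext.
have qt : q' \og t = q by apply: gmap_ext.
by rewrite -(mk_iso _ _ tt' t't erefl) -!(sm_res_comp (m_mackey _)) pt qt.
Qed.

(** The pullback of [f \og g] is pasted from two squares. The second one and the Mackey formula turn
    the relation for [g] into the relation for its pullback. *)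
Lemma cres_bal X Y (h : gmap X Y) :
  balanced (fun Z (f : gmap Z Y) (m : M Z) (n : N Z) =>
    mk (pbk2 f h) (mres M (pbk1 f h) m) (mres N (pbk1 f h) n)).
Proof.
split=> [Z Z' f g m n|Z Z' f g m n|Z f a m n]; last by rewrite !mresZ mkZ.
- have P := pbkP f h; have P' := pbkP (pbk1 f h) g.
  have PP := pb_sym (pb_paste (pb_sym P) P').
  rewrite (mk_pb_eq _ _ (pbkP (f \og g) h) PP).
  rewrite -(sm_res_comp (m_mackey N)) -(_ : pbk1 f h \og pbk1 (pbk1 f h) g = g \og pbk2 (pbk1 f h) g).
    by rewrite (sm_res_comp (m_mackey N)) mkL (sm_pullback (m_mackey M) (pb_sym P')).
  exact/gmap_ext/P'.1.
- have P := pbkP f h; have P' := pbkP (pbk1 f h) g.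
  have PP := pb_sym (pb_paste (pb_sym P) P').
  rewrite (mk_pb_eq _ _ (pbkP (f \og g) h) PP).
  rewrite -(sm_res_comp (m_mackey M)) -(_ : pbk1 f h \og pbk1 (pbk1 f h) g = g \og pbk2 (pbk1 f h) g).
    by rewrite (sm_res_comp (m_mackey M)) mkR (sm_pullback (m_mackey N) (pb_sym P')).
  exact/gmap_ext/P'.1.
Qed.

Lemma cresE X Y Z W (f : gmap Z Y) (h : gmap X Y) (p : gmap W Z) (q : gmap W X) m n :
  is_pullback f h p q -> cres h (mk f m n) = mk q (mres M p m) (mres N p n).
Proof.
by move=> P; rewrite /cres (cliftE (cres_bal h)); apply: mk_pb_eq (pbkP f h) P.
Qed.

Lemma cresD X Y (h : gmap X Y) : zmod_morphism (cres h).
Proof.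
have D c c' : cres h (c + c') = cres h c + cres h c'.
  have [Z [f [m [n ->]]]] := mkP c; have [Z' [f' [m' [n' ->]]]] := mkP c'.
  rewrite mk_add (cresE _ _ (pb_case (pbkP f h) (pbkP f' h))) !mres_plus.
  by rewrite -mk_add !(cresE _ _ (pbkP _ h)).
move=> c c'; apply: (@addIr _ (cres h c')).
by rewrite -D !subrK.
Qed.

Lemma ctrD X Y (h : gmap X Y) : zmod_morphism (ctr h).
Proof.
have D c c' : ctr h (c + c') = ctr h c + ctr h c'.
  have [Z [f [m [n ->]]]] := mkP c; have [Z' [f' [m' [n' ->]]]] := mkP c'.
  rewrite !(mk_add, ctrE); congr mk; by apply: gmap_ext => -[].
move=> c c'; apply: (@addIr _ (ctr h c')).
by rewrite -D !subrK.
Qed.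

HB.instance Definition _ X Y (h : gmap X Y) :=
  GRing.isZmodMorphism.Build (coend Y) (coend X) (cres h) (cresD h).
HB.instance Definition _ X Y (h : gmap X Y) :=
  GRing.isZmodMorphism.Build (coend X) (coend Y) (ctr h) (ctrD h).

Lemma coend_empty X (c : coend X) : (X -> False) -> c = 0.
Proof. by have [Y [f [m [n ->]]]] := mkP c => X0; apply: mk_empty => y; apply: X0 (f y). Qed.

Lemma cres_id X (c : coend X) : cres gmap_id c = c.
Proof.
have [Y [f [m [n ->]]]] := mkP c.
by rewrite (cresE _ _ (pb_id f)) !(sm_res_id (m_mackey _)).
Qed.

Lemma cres_tr X Y Z W (f : gmap X Z) (h : gmap Y Z) (p : gmap W X) (q : gmap W Y) c :
  is_pullback f h p q -> cres h (ctr f c) = ctr q (cres p c).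
Proof.
move=> P; have [Y' [g [m [n ->]]]] := mkP c; rewrite ctrE (cresE _ _ (pbkP g p)) ctrE.
by rewrite (cresE _ _ (pb_sym (pb_paste (pb_sym P) (pb_sym (pbkP g p))))).
Qed.

Lemma cres_disjoint X Y Z (f : gmap X Z) (h : gmap Y Z) c :
  (forall x y, f x <> h y) -> cres h (ctr f c) = 0.
Proof.
by move=> fh; rewrite (cres_tr _ (pb_void fh)) (coend_empty (cres _ c)) ?raddf0.
Qed.

Lemma coend_mackey : @semi_mackey gT coend cres ctr.
Proof.
have RI X Y (f : gmap X Y) c : injective f -> cres f (ctr f c) = c.
  move=> fi; rewrite (cres_tr _ (pb_mono fi)) cres_id.
  by have [Z [g [m [n ->]]]] := mkP c; rewrite ctrE; congr mk; apply: gmap_ext.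
split.
- exact: cres_id.
- move=> X Y Z f h c; have [Y' [g [m [n ->]]]] := mkP c.
  rewrite (cresE _ _ (pbkP g f)) (cresE _ _ (pbkP (pbk2 g f) h)).
  by rewrite (cresE _ _ (pb_paste (pbkP g f) (pbkP (pbk2 g f) h))) !(sm_res_comp (m_mackey _)).
- by move=> X c; have [Z [g [m [n ->]]]] := mkP c; rewrite ctrE; congr mk; apply: gmap_ext.
- by move=> X Y Z f h c; have [Y' [g [m [n ->]]]] := mkP c; rewrite !ctrE; congr mk; apply: gmap_ext.
- by move=> X Y Z W f h p q P c; apply: cres_tr.
- by move=> X X0 a b; rewrite (coend_empty a X0) (coend_empty b X0).
move=> X Y Z i j ijP a b; have [ii ji ij _] := ijP.
have ji' y x : j y <> i x by move=> /esym/ij.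
exists (ctr i a + ctr j b); split=> [|c [<- <-]].
  by rewrite !raddfD /= !RI // (cres_disjoint _ ij) (cres_disjoint _ ji') addr0 add0r.
have [Z' [f [m [n ->]]]] := mkP c.
rewrite !(cresE _ _ (pbkP f _)) !ctrE mk_add.
(* Uniqueness of gluing: [Z'] is the disjoint union of the parts that [f] sends into [X] and into
   [Y]. The map [t] is this decomposition, so the sum of the two restricted triples is isomorphic to
   the original one. *)
set u := gcase _ _; pose t := gcase (pbk1 f i) (pbk1 f j).
have fi := (pbkP f i).1; have fj := (pbkP f j).1.
have [||h hK] := @gmap_bij _ _ _ t.
- case=> [v|v] [w|w] vw.
  + by congr inl; apply: (pb_inj (pbkP f i) vw); apply: ii; rewrite -!fi; congr (f _).
  + by case: (ij (pbk2 f i v) (pbk2 f j w)); rewrite -fi -fj; congr (f _).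
  + by case: (ij (pbk2 f i w) (pbk2 f j v)); rewrite -fi -fj; congr (f _).
  + by congr inr; apply: (pb_inj (pbkP f j) vw); apply: ji; rewrite -!fj; congr (f _).
- move=> y; have [_ _ _ /(_ (f y)) [[x /esym fy]|[x /esym fy]]] := ijP.
    by have [w [<- _]] := pb_ex (pbkP f i) fy; exists (inl w).
  by have [w [<- _]] := pb_ex (pbkP f j) fy; exists (inr w).
rewrite -(mk_iso m n hK.1 hK.2 erefl) !m_res_case; congr mk.
by apply: gmap_ext => -[x|x]; [exact: esym (fi x)|exact: esym (fj x)].
Qed.

Definition cscale X (a : k X) (c : coend X) : coend X :=
  clift (fun Y (f : gmap Y X) m n => mk f (res f a *: m) n) c.

Lemma cscale_bal X (a : k X) :
  balanced (fun Y (f : gmap Y X) (m : M Y) (n : N Y) => mk f (res f a *: m) n).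
Proof.
split=> [Z Z' f g m n|Z Z' f g m n|Z f b m n].
- by rewrite (sm_res_comp (res_tr_mackey k)) mkL mtr_resl.
- by rewrite (sm_res_comp (res_tr_mackey k)) -mresZ mkR.
by rewrite scalerA mulrC -scalerA mkZ.
Qed.

Lemma cscaleE X (a : k X) Y (f : gmap Y X) m n :
  cscale a (mk f m n) = mk f (res f a *: m) n.
Proof. exact: (cliftE (cscale_bal a)). Qed.

Lemma cscaleA X (a b : k X) c : cscale a (cscale b c) = cscale (a * b) c.
Proof.
by have [Y [f [m [n ->]]]] := mkP c; rewrite !cscaleE scalerA rmorphM.
Qed.

Lemma cscale1 X : left_id 1 (@cscale X).
Proof. by move=> c; have [Y [f [m [n ->]]]] := mkP c; rewrite cscaleE rmorph1 scale1r. Qed.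

Lemma cscaleDr X : right_distributive (@cscale X) +%R.
Proof.
move=> a c c'; have [Z [f [m [n ->]]]] := mkP c; have [Z' [f' [m' [n' ->]]]] := mkP c'.
rewrite !(cscaleE, mk_add); congr mk; apply: mcatE; rewrite mresZ ?mcatl ?mcatr //.
  by rewrite -(sm_res_comp (res_tr_mackey k)); congr (res _ _ *: _); apply: gmap_ext.
by rewrite -(sm_res_comp (res_tr_mackey k)); congr (res _ _ *: _); apply: gmap_ext.
Qed.

Lemma cscaleDl X (c : coend X) : {morph (@cscale X)^~ c : a b / a + b}.
Proof.
move=> a b; have [Y [f [m [n ->]]]] := mkP c.
by rewrite !cscaleE raddfD scalerDl mkDl.
Qed.

HB.instance Definition _ X := GRing.Zmodule_isLmodule.Build (k X) (coend X)
  (@cscaleA X) (@cscale1 X) (@cscaleDr X) (@cscaleDl X).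

Lemma cZE X (a : k X) Y (f : gmap Y X) m n : a *: mk f m n = mk f (res f a *: m) n.
Proof. exact: cscaleE. Qed.

Lemma coend_resZ X Y (h : gmap X Y) (a : k Y) (c : coend Y) :
  cres h (a *: c) = res h a *: cres h c.
Proof.
have [Z [f [m [n ->]]]] := mkP c; rewrite cZE !(cresE _ _ (pbkP f h)) cZE mresZ.
rewrite -!(sm_res_comp (res_tr_mackey k)); congr (mk _ (res _ _ *: _) _).
exact/gmap_ext/(pbkP f h).1.
Qed.

Lemma coend_tr_resl X Y (h : gmap X Y) (a : k Y) (c : coend X) :
  ctr h (res h a *: c) = a *: ctr h c.
Proof.
have [Z [f [m [n ->]]]] := mkP c; rewrite !(cZE, ctrE) (sm_res_comp (res_tr_mackey k)) //.
Qed.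

Lemma coend_tr_resr X Y (h : gmap X Y) (a : k X) (c : coend Y) :
  ctr h (a *: cres h c) = tr h a *: c.
Proof.
have [Z [f [m [n ->]]]] := mkP c; have P := pbkP f h.
have fq : f \og pbk1 f h = h \og pbk2 f h by apply/gmap_ext/P.1.
rewrite (cresE _ _ P) !cZE ctrE -fq mkL mtr_resr.
by rewrite (sm_pullback (res_tr_mackey k) (pb_sym P)).
Qed.

Definition coend_module : kmodule k := @KModule gT k coend cres ctr
  coend_mackey coend_resZ coend_tr_resl coend_tr_resr.

End CoendModule.

(** * Products as norms, and norms over a two-step dependent product *)

Section TambaraFolds.

Variables (gT : finGroupType) (T : tambara gT).
Implicit Types X Y Z A E W V U : gset gT.

Definition tcat X Y (a : T X) (b : T Y) : T (gsum X Y) :=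
  tr (gl X Y) a + tr (gr X Y) b.

Lemma t_void_eq X (a b : T X) : (X -> False) -> a = b.
Proof. by move=> X0; apply: (sm_empty (res_tr_mackey T)). Qed.

Lemma t_disjoint X Y Z (f : gmap X Z) (h : gmap Y Z) (a : T X) :
  (forall x y, f x <> h y) -> res h (tr f a) = 0.
Proof.
move=> fh; rewrite (sm_pullback (res_tr_mackey T) (pb_void fh)).
by rewrite (@t_void_eq _ (res _ a) 0) ?raddf0.
Qed.

Lemma tcatl X Y (a : T X) (b : T Y) : res (gl X Y) (tcat a b) = a.
Proof.
by rewrite rmorphD (sm_mono (res_tr_mackey T) _ (@gl_inj _ _ _)) t_disjoint ?addr0.
Qed.

Lemma tcatr X Y (a : T X) (b : T Y) : res (gr X Y) (tcat a b) = b.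
Proof.
by rewrite rmorphD (sm_mono (res_tr_mackey T) _ (@gr_inj _ _ _)) t_disjoint ?add0r.
Qed.

Lemma nm_disjoint X Y Z (f : gmap X Z) (h : gmap Y Z) (a : T X) :
  (forall x y, f x <> h y) -> res h (nm f a) = 1.
Proof.
move=> fh; rewrite (sm_pullback (res_nm_mackey T) (pb_void fh)).
by rewrite (@t_void_eq _ (res _ a) 1) ?nm1.
Qed.

Lemma nm_fold X (a b : T X) : nm (gfold X) (tcat a b) = a * b.
Proof.
(* A norm along an inclusion extends an element by 1 where a transfer extends it by 0, so the glued
   element is a product as well as a sum. *)
have -> : tcat a b = nm (gl X X) a * nm (gr X X) b.
  apply: (sm_inj (res_nm_mackey T)); rewrite rmorphM ?tcatl ?tcatr.
    by rewrite (sm_mono (res_nm_mackey T) _ (@gl_inj _ _ _)) nm_disjoint ?mulr1.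
  by rewrite (sm_mono (res_nm_mackey T) _ (@gr_inj _ _ _)) nm_disjoint ?mul1r.
rewrite nmM -!(sm_tr_comp (res_nm_mackey T)).
by congr (_ * _); rewrite -[RHS](sm_tr_id (res_nm_mackey T)); congr nm; apply: gmap_ext.
Qed.

Section ExpoCompP.

Variables (A X Z E W A' V E' U : gset gT) (p : gmap A X) (f : gmap X Z).
Variables (e : gmap E Z) (w1 : gmap W X) (w2 : gmap W E) (ev : gmap W A).
Variables (g : gmap A' A) (v1 : gmap V W) (v2 : gmap V A').
Variables (e' : gmap E' E) (u1 : gmap U W) (u2 : gmap U E') (ev' : gmap U V).
Hypothesis PV : is_pullback ev g v1 v2.
Hypothesis H' : is_exponential v1 w2 e' u1 u2 ev'.

(** A transfer along [g] inside the norm comes out as a transfer along [e']; [nm_expo_res] does the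
    same for a restriction. Together they carry the Frobenius relation for [g] to the one for
    [e']. *)
Lemma nm_expo_tr (a : T A') :
  tr e' (nm u2 (res (v2 \og ev') a)) = nm w2 (res ev (tr g a)).
Proof.
rewrite (sm_pullback (res_tr_mackey T) (pb_sym PV)) (nm_tr H').
by rewrite (sm_res_comp (res_tr_mackey T)).
Qed.

Lemma nm_expo_res (a : T A) :
  nm u2 (res (v2 \og ev') (res g a)) = res e' (nm w2 (res ev a)).
Proof.
rewrite (sm_pullback (res_nm_mackey T) (expo_pb H')).
congr nm; rewrite -!(sm_res_comp (res_tr_mackey T)); congr (res _ a).
by apply: gmap_ext => x /=; rewrite -(expo_ev H') PV.1.
Qed.

End ExpoCompP.

End TambaraFolds.

(** * Norms on the coend of two algebras, and the resulting Tambara functor *)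

Section Norms.

Variables (gT : finGroupType) (k : tambara gT) (R S : kalgebra k).
Implicit Types X Y Z A E W : gset gT.
Local Notation M := (alg_module R).
Local Notation N := (alg_module S).
Local Notation mk := (@cmk _ k M N _ _).
Local Notation coend := (coend M N).

Definition nm_pt A Z E W (e : gmap E Z) (w2 : gmap W E) (ev : gmap W A)
    (r : R A) (s : S A) : coend Z :=
  mk e (nm w2 (res ev r)) (nm w2 (res ev s)).

(** The norm may be computed on any dependent product diagram, in particular on one assembled by
    pasting. *)
Lemma nm_pt_eq A X Z E W E' W' (p : gmap A X) (f : gmap X Z)
    (e : gmap E Z) (w1 : gmap W X) (w2 : gmap W E) (ev : gmap W A)
    (e' : gmap E' Z) (w1' : gmap W' X) (w2' : gmap W' E') (ev' : gmap W' A) r s :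
    is_exponential p f e w1 w2 ev -> is_exponential p f e' w1' w2' ev' ->
  nm_pt e w2 ev r s = nm_pt e' w2' ev' r s.
Proof.
move=> H H'; have [t [t' [u [tt' t't et P uv]]]] := expo_unique H H'.
have resE (T : tambara gT) (x : T A) : res t (nm w2' (res ev' x)) = nm w2 (res ev x).
  rewrite (sm_pullback (res_nm_mackey T) P); congr nm.
  by rewrite -(sm_res_comp (res_tr_mackey T)); congr (res _ x); apply: gmap_ext.
rewrite /nm_pt -!resE; apply: (mk_iso (M := M) (N := N) _ _ tt' t't).
exact: gmap_ext.
Qed.

Definition cnm X Z (f : gmap X Z) (c : coend X) : coend Z :=
  clift (fun A (p : gmap A X) (r : M A) (s : N A) =>
    nm_pt (expo_e p f) (expo_w2 p f) (expo_eval p f) r s) c.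

Lemma cnm_bal X Z (f : gmap X Z) :
  balanced (fun A (p : gmap A X) (r : M A) (s : N A) =>
    nm_pt (expo_e p f) (expo_w2 p f) (expo_eval p f) r s).
Proof.
split=> [A A' p g r s|A A' p g r s|A p a r s].
- pose H := expoP p f; pose PV := pbkP (expo_eval p f) g.
  pose H' := expoP (pbk1 (expo_eval p f) g) (expo_w2 p f).
  rewrite (nm_pt_eq _ _ (expoP _ f) (expo_comp_p H PV H')) /nm_pt.
  rewrite (nm_expo_res PV H') (mkL (M := M) (N := N)).
  congr cmk; exact: nm_expo_tr PV H' _.
- pose H := expoP p f; pose PV := pbkP (expo_eval p f) g.
  pose H' := expoP (pbk1 (expo_eval p f) g) (expo_w2 p f).
  rewrite (nm_pt_eq _ _ (expoP _ f) (expo_comp_p H PV H')) /nm_pt.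
  rewrite (nm_expo_res PV H') (mkR (M := M) (N := N)).
  congr cmk; exact: nm_expo_tr PV H' _.
(* A scalar leaves the norm as its own norm in [k]. As the units of [R] and [S] commute with norms,
   it is the same scalar for both factors and can change sides. *)
pose b : k _ := nm (expo_w2 p f) (res (expo_eval p f) a).
have bE (T : kalgebra k) (t : alg_module T A) :
    nm (expo_w2 p f) (res (expo_eval p f) (a *: t : T A)) =
    b *: (nm (expo_w2 p f) (res (expo_eval p f) (t : T A)) : alg_module T _).
  by rewrite [a *: t]/GRing.scale [RHS]/GRing.scale /= rmorphM nmM th_nm th_res.
rewrite /nm_pt [nm _ (res _ (a *: r))]bE [nm _ (res _ (a *: s))]bE.
exact: (mkZ (M := M) (N := N)).
Qed.

Lemma cnmE A X Z E W (p : gmap A X) (f : gmap X Z)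
    (e : gmap E Z) (w1 : gmap W X) (w2 : gmap W E) (ev : gmap W A) r s :
  is_exponential p f e w1 w2 ev -> cnm f (mk p r s) = nm_pt e w2 ev r s.
Proof.
by move=> H; rewrite /cnm (cliftE (cnm_bal f)); apply: nm_pt_eq (expoP p f) H.
Qed.

(** The axioms on restrictions alone are those of the additive structure. The identity, composition
    and pullback axioms for norms come from [expo_along_id], [expo_comp_f] and [expo_bc]. *)
Lemma coend_nm_mackey : @semi_mackey gT coend (@cres _ _ M N) cnm.
Proof.
have H0 := coend_mackey M N; split; try by case: H0.
- move=> X c; have [A [p [r [s ->]]]] := mkP c.
  rewrite (cnmE _ _ (expo_along_id p)) /nm_pt.
  by rewrite !(sm_res_id (res_tr_mackey _)) !(sm_tr_id (res_nm_mackey _)).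
- move=> X Y Z f h c; have [A [p [r [s ->]]]] := mkP c.
  have H := expoP p h; have H' := expoP (expo_e p h) f.
  have PV := pbkP (expo_w2 p h) (expo_eval (expo_e p h) f).
  rewrite (cnmE _ _ H) /nm_pt (cnmE _ _ H') (cnmE _ _ (expo_comp_f H H' PV)) /nm_pt.
  by rewrite !(sm_pullback (res_nm_mackey _) PV) !(sm_tr_comp (res_nm_mackey _))
    !(sm_res_comp (res_tr_mackey _)).
move=> X Y Z W f h p q PX c; have [A [u [r [s ->]]]] := mkP c.
have H := expoP u f; have PA := pbkP u p; have PE := pbkP (expo_e u f) h.
set n := pbk1 _ _ in PE; set e' := pbk2 _ _ in PE.
have PW := pbkP (expo_w2 u f) n; set o := pbk1 _ _ in PW; set w2' := pbk2 _ _ in PW.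
(* The remaining legs of the pulled-back dependent product diagram, [w1'] and then [ev'], come from
   the universal properties of the pullbacks [W] and [pbk u p]. *)
have [w1' [pw qw]] : exists t : gmap (pbk (expo_w2 u f) n) W,
    (forall x, p (t x) = (u \og expo_eval u f \og o) x) /\ (forall x, q (t x) = (e' \og w2') x).
  apply: (pb_map PX) => x; rewrite /= -PE.1.
  by rewrite -[n _]PW.1; exact: (expo_pb H).1.
have [ev' [av pv]] : exists t : gmap (pbk (expo_w2 u f) n) (pbk u p),
    (forall x, pbk1 u p (t x) = (expo_eval u f \og o) x) /\ (forall x, pbk2 u p (t x) = w1' x).
  by apply: (pb_map PA) => x; rewrite pw.
have H' := expo_bc H PX PA PE PW pw qw av pv.
rewrite (cnmE _ _ H) (cresE _ _ PE) (cresE _ _ PA) (cnmE _ _ H') /nm_pt.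
have E (T : tambara gT) (t : T A) : res n (nm (expo_w2 u f) (res (expo_eval u f) t)) =
    nm w2' (res ev' (res (pbk1 u p) t)).
  rewrite (sm_pullback (res_nm_mackey T) PW) -!(sm_res_comp (res_tr_mackey T)).
  by congr (nm _ (res _ t)); apply: gmap_ext => x; exact: esym (av x).
by congr cmk; apply: E.
Qed.

(** The transfer of a triple is the triple over the composite [p \og g], so the distributive law is
    the two-step computation of its dependent product. *)
Lemma coend_nm_tr A X Z E W (p : gmap A X) (f : gmap X Z) (e : gmap E Z)
    (w1 : gmap W X) (w2 : gmap W E) (ev : gmap W A) :
  is_exponential p f e w1 w2 ev ->
  forall c : coend A, cnm f (ctr p c) = ctr e (cnm w2 (cres ev c)).
Proof.
move=> H c; have [A' [g [r [s ->]]]] := mkP c.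
have PV := pbkP ev g; have H' := expoP (pbk1 ev g) w2.
rewrite ctrE (cnmE _ _ (expo_comp_p H PV H')) (cresE _ _ (pb_sym PV)) (cnmE _ _ H') ctrE.
by rewrite /nm_pt !(sm_res_comp (res_tr_mackey _)).
Qed.

(** * The coproduct of two algebras *)

(** A separate name for the coend, to which the ring structure is attached: coends of general
    modules have none. *)
Definition tens X : Type := coend X.

HB.instance Definition _ X := GRing.Zmodule.on (tens X).

Definition tres X Y (f : gmap X Y) : tens Y -> tens X := @cres _ _ M N X Y f.
Definition ttr X Y (f : gmap X Y) : tens X -> tens Y := @ctr _ _ M N X Y f.
Definition tnm X Y (f : gmap X Y) : tens X -> tens Y := @cnm X Y f.

HB.instance Definition _ X Y (f : gmap X Y) :=
  GRing.isZmodMorphism.Build (tens Y) (tens X) (tres f) (cresD f).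
HB.instance Definition _ X Y (f : gmap X Y) :=
  GRing.isZmodMorphism.Build (tens X) (tens Y) (ttr f) (ctrD f).

Let HT : @semi_mackey gT tens tres ttr := coend_mackey M N.
Let HN : @semi_mackey gT tens tres tnm := coend_nm_mackey.

Definition tmul X (a b : tens X) : tens X := sm_op HN a b.
Definition tone X : tens X := tnm (from_void X) 0.

Lemma tone_mul X : left_id (@tone X) (@tmul X).
Proof. exact: (sm_op_unit HN). Qed.

Lemma tglueE X Y (a : tens X) (b : tens Y) : sm_glue HN a b = sm_glue HT a b.
Proof. by apply: (sm_glueE HT); rewrite ?(sm_gluel HN) ?(sm_gluer HN). Qed.

(** A product is a norm along the fold, and the glued pair is a transfer along [gplus f gmap_id].
    The distributive law for the diagram of [expo_fold] then yields Frobenius reciprocity. *)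
Lemma tmul_tr X Y (f : gmap X Y) a b : tmul (ttr f a) b = ttr f (tmul a (tres f b)).
Proof.
rewrite /tmul /sm_op !tglueE -[b in LHS](sm_tr_id HT) -(sm_tr_glue HT).
rewrite [LHS](coend_nm_tr (expo_fold f)); congr (ttr f (tnm _ _)).
by rewrite [LHS](sm_res_glue HT) (sm_res_id HT).
Qed.

Lemma tres_mul X Y (f : gmap X Y) a b : tres f (tmul a b) = tmul (tres f a) (tres f b).
Proof. exact: (sm_op_res HN). Qed.

Lemma tglue_add X Y (a : tens X) (b : tens Y) :
  sm_glue HT a b = ttr (gl X Y) a + ttr (gr X Y) b.
Proof.
symmetry; apply: (sm_glueE HT); rewrite raddfD /=.
  rewrite (sm_mono HT _ (@gl_inj _ _ _)).
  by rewrite [tres _ (ttr _ b)](@cres_disjoint _ _ M N) // addr0.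
rewrite (sm_mono HT _ (@gr_inj _ _ _)).
by rewrite [tres _ (ttr _ a)](@cres_disjoint _ _ M N) // add0r.
Qed.

Lemma tadd_fold X (a b : tens X) : a + b = ttr (gfold X) (sm_glue HT a b).
Proof.
rewrite tglue_add raddfD /= -!(sm_tr_comp HT).
by congr (_ + _); rewrite -[LHS](sm_tr_id HT); congr ttr; apply: gmap_ext.
Qed.

(** A sum is a transfer along the fold, so this is Frobenius reciprocity for the fold. *)
Lemma tmulDl X : left_distributive (@tmul X) +%R.
Proof.
move=> a b c; rewrite [a + b]tadd_fold tmul_tr [RHS]tadd_fold; congr (ttr _ _).
have fl : gfold X \og gl X X = gmap_id by apply: gmap_ext.
have fr : gfold X \og gr X X = gmap_id by apply: gmap_ext.
apply: (sm_glueE HT); rewrite tres_mul.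
  by rewrite (sm_gluel HT) (sm_res_eq HT c fl) (sm_res_id HT).
by rewrite (sm_gluer HT) (sm_res_eq HT c fr) (sm_res_id HT).
Qed.

HB.instance Definition _ X := GRing.Zmodule_isComPzRing.Build (tens X)
  (@sm_opA _ _ _ _ HN X) (@sm_opC _ _ _ _ HN X) (@tone_mul X) (@tmulDl X).

Lemma tres_monoid X Y (f : gmap X Y) : monoid_morphism (tres f).
Proof. by split; [exact: (sm_void_res HN)|exact: tres_mul]. Qed.

HB.instance Definition _ X Y (f : gmap X Y) :=
  GRing.isMonoidMorphism.Build (tens Y) (tens X) (tres f) (tres_monoid f).

Lemma tnm1 X Y (f : gmap X Y) : tnm f 1 = 1.
Proof. exact: (sm_void_tr HN). Qed.

Lemma tnmM X Y (f : gmap X Y) : {morph tnm f : a b / a * b}.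
Proof. exact: (sm_op_tr HN). Qed.

Lemma ttr_mul_res X Y (f : gmap X Y) (a : tens X) (b : tens Y) :
  ttr f (a * tres f b) = ttr f a * b.
Proof. by rewrite [RHS]tmul_tr. Qed.

Definition tens_tambara : tambara gT :=
  @Tambara gT tens (fun X Y f => tres f) (fun X Y f => ttr f) tnm
    tnm1 tnmM ttr_mul_res HT HN coend_nm_tr.

End Norms.

(** * The coend of two algebras is their coproduct *)

Section TensorAlgebra.

Variables (gT : finGroupType) (k : tambara gT) (R S : kalgebra k).
Implicit Types X Y Z : gset gT.
Local Notation M := (alg_module R).
Local Notation N := (alg_module S).
Local Notation mk := (@cmk _ k M N _ _).
Local Notation T := (tens_tambara R S).

Definition pt X (r : R X) (s : S X) : T X := mk gmap_id r s.

Lemma mk_pt X Y (p : gmap Y X) r s : mk p r s = tr p (pt r s) :> T X.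
Proof. by rewrite [RHS](@ctrE _ _ M N); congr cmk; apply: gmap_ext. Qed.

Lemma pt_res X Y (f : gmap X Y) r s : res f (pt r s) = pt (res f r) (res f s).
Proof. exact: cresE (pb_sym (pb_id f)). Qed.

Lemma pt_nm X Y (f : gmap X Y) r s : nm f (pt r s) = pt (nm f r) (nm f s).
Proof.
rewrite [LHS](cnmE _ _ (expo_id f)) /nm_pt.
by rewrite !(sm_res_id (res_tr_mackey _)).
Qed.

(** Both products are norms along the fold. Norms of pure tensors are taken factor by factor,
    because the dependent product of an identity map is an identity map. *)
Lemma ptM X (r r' : R X) (s s' : S X) : pt r s * pt r' s' = pt (r * r') (s * s').
Proof.
rewrite -!nm_fold -pt_nm; congr (nm _ _); symmetry.
by apply: (sm_inj (res_tr_mackey T)); rewrite pt_res !(tcatl, tcatr).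
Qed.

Lemma pt1 X : pt 1 1 = 1 :> T X.
Proof.
have E (Q : tambara gT) : 1 = nm (from_void X) 1 :> Q X by rewrite nm1.
by rewrite (E R) (E S) (E T) -pt_nm; congr nm; apply: t_void_eq; case.
Qed.

Definition tinl_fun X (r : R X) : T X := pt r 1.
Definition tinr_fun X (s : S X) : T X := pt 1 s.

Lemma tinl_zmod X : zmod_morphism (@tinl_fun X).
Proof.
by move=> r r'; apply: (@addIr _ (tinl_fun r')); rewrite /tinl_fun -mkDl !subrK.
Qed.

Lemma tinr_zmod X : zmod_morphism (@tinr_fun X).
Proof.
by move=> s s'; apply: (@addIr _ (tinr_fun s')); rewrite /tinr_fun -mkDr !subrK.
Qed.

Lemma tinl_monoid X : monoid_morphism (@tinl_fun X).
Proof. by split=> [|r r']; rewrite /tinl_fun ?pt1 // ptM mulr1. Qed.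

Lemma tinr_monoid X : monoid_morphism (@tinr_fun X).
Proof. by split=> [|s s']; rewrite /tinr_fun ?pt1 // ptM mulr1. Qed.

HB.instance Definition _ X := GRing.isZmodMorphism.Build (R X) (T X) (@tinl_fun X) (@tinl_zmod X).
HB.instance Definition _ X := GRing.isMonoidMorphism.Build (R X) (T X) (@tinl_fun X) (@tinl_monoid X).
HB.instance Definition _ X := GRing.isZmodMorphism.Build (S X) (T X) (@tinr_fun X) (@tinr_zmod X).
HB.instance Definition _ X := GRing.isMonoidMorphism.Build (S X) (T X) (@tinr_fun X) (@tinr_monoid X).

Lemma tinl_res X Y (f : gmap X Y) r : tinl_fun (res f r) = res f (tinl_fun r).
Proof. by rewrite /tinl_fun pt_res rmorph1. Qed.

Lemma tinr_res X Y (f : gmap X Y) s : tinr_fun (res f s) = res f (tinr_fun s).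
Proof. by rewrite /tinr_fun pt_res rmorph1. Qed.

Lemma tinl_tr X Y (f : gmap X Y) r : tinl_fun (tr f r) = tr f (tinl_fun r).
Proof.
rewrite /tinl_fun -mk_pt; apply: etrans (esym (mkL (M := M) (N := N) gmap_id f r 1)) _.
by congr cmk; [exact: gmap_ext|exact: rmorph1].
Qed.

Lemma tinr_tr X Y (f : gmap X Y) s : tinr_fun (tr f s) = tr f (tinr_fun s).
Proof.
rewrite /tinr_fun -mk_pt; apply: etrans (esym (mkR (M := M) (N := N) gmap_id f 1 s)) _.
by congr cmk; [exact: gmap_ext|exact: rmorph1].
Qed.

Lemma tinl_nm X Y (f : gmap X Y) r : tinl_fun (nm f r) = nm f (tinl_fun r).
Proof. by rewrite /tinl_fun pt_nm nm1. Qed.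

Lemma tinr_nm X Y (f : gmap X Y) s : tinr_fun (nm f s) = nm f (tinr_fun s).
Proof. by rewrite /tinr_fun pt_nm nm1. Qed.

Definition tinl_hom : tambara_hom R T :=
  @TambaraHom _ R T (fun X => @tinl_fun X) tinl_res tinl_tr tinl_nm.
Definition tinr_hom : tambara_hom S T :=
  @TambaraHom _ S T (fun X => @tinr_fun X) tinr_res tinr_tr tinr_nm.

Definition tambara_comp (T1 T2 T3 : tambara gT) (u : tambara_hom T2 T3)
    (v : tambara_hom T1 T2) : tambara_hom T1 T3.
Proof.
refine (@TambaraHom _ T1 T3 (fun X => u X \o v X) _ _ _) => X Y f a /=.
- by rewrite !th_res.
- by rewrite !th_tr.
- by rewrite !th_nm.
Defined.

Definition tens_alg : kalgebra k := KAlgebra (tambara_comp tinl_hom (alg_unit R)).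

Lemma tinl_unit X a : tinl_hom X (alg_unit R X a) = alg_unit tens_alg X a.
Proof. by []. Qed.

(** The structure map of [tens_alg] passes through [R]. The relation [mkZ] identifies it with the
    one through [S]. *)
Lemma tinr_unit X a : tinr_hom X (alg_unit S X a) = alg_unit tens_alg X a.
Proof.
have E : mk gmap_id (alg_unit R X a * 1) 1 = mk gmap_id 1 (alg_unit S X a * 1).
  exact: (mkZ (M := M) (N := N) gmap_id a (1 : R X) (1 : S X)).
by rewrite !mulr1 in E; exact: esym E.
Qed.

Definition tinl : kalgebra_hom R tens_alg :=
  @KAlgebraHom _ k R tens_alg tinl_hom tinl_unit.
Definition tinr : kalgebra_hom S tens_alg :=
  @KAlgebraHom _ k S tens_alg tinr_hom tinr_unit.

Lemma tinlr X Y (p : gmap Y X) r s : mk p r s = tr p (tinl Y r * tinr Y s) :> tens_alg X.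
Proof. by rewrite mk_pt [_ * _]ptM mul1r mulr1. Qed.

Section Lift.

Variables (Q : kalgebra k) (f : kalgebra_hom R Q) (h : kalgebra_hom S Q).

Let phi X Y (p : gmap Y X) (r : M Y) (s : N Y) : Q X := tr p (f Y r * h Y s).

Definition tlift_fun X (c : T X) : Q X := clift (@phi X) c.

Lemma phi_bal X : balanced (@phi X).
Proof.
rewrite /phi; split=> [Y Y' p g r s|Y Y' p g r s|Y p a r s].
- by rewrite (sm_tr_comp (res_tr_mackey _)) th_res tr_mul_res th_tr.
- rewrite (sm_tr_comp (res_tr_mackey _)) mulrC th_res tr_mul_res [RHS](congr1 _ (mulrC _ _)).
  by rewrite th_tr.
rewrite [a *: r]/GRing.scale [a *: s]/GRing.scale /= !rmorphM !ah_unit.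
by congr (tr p _); rewrite [RHS]mulrCA mulrA.
Qed.

Lemma tliftE X Y (p : gmap Y X) r s : tlift_fun (mk p r s) = tr p (f Y r * h Y s).
Proof. exact: (cliftE (phi_bal X)). Qed.

Lemma tlift_tr X Y (g : gmap X Y) c : tlift_fun (tr g c) = tr g (tlift_fun c).
Proof.
have [Z [p [r [s ->]]]] := mkP c.
by rewrite [tr g _](@ctrE _ _ M N) !tliftE (sm_tr_comp (res_tr_mackey _)).
Qed.

Lemma tlift_res X Y (g : gmap X Y) c : tlift_fun (res g c) = res g (tlift_fun c).
Proof.
have [Z [p [r [s ->]]]] := mkP c; have P := pbkP p g.
rewrite [res g _](@cresE _ _ M N _ _ _ _ _ _ _ _ _ _ P) !tliftE.
by rewrite (sm_pullback (res_tr_mackey _) P) rmorphM !th_res.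
Qed.

(** The norm of a triple was defined by the very formula that [nm_tr] gives for the norm of a
    transfer in [Q]. *)
Lemma tlift_nm X Y (g : gmap X Y) c : tlift_fun (nm g c) = nm g (tlift_fun c).
Proof.
have [Z [p [r [s ->]]]] := mkP c; have P := expoP p g.
rewrite [nm g _](cnmE _ _ P) !tliftE (nm_tr P) rmorphM nmM.
by rewrite !th_nm !th_res.
Qed.

Lemma tlift_add X (c c' : T X) : tlift_fun (c + c') = tlift_fun c + tlift_fun c'.
Proof.
have [Y [p [r [s ->]]]] := mkP c; have [Y' [p' [r' [s' ->]]]] := mkP c'.
rewrite [_ + _](@mk_add _ _ M N) !tliftE.
have fE : f _ (mcat r r') = tcat (f Y r) (f Y' r') by rewrite rmorphD /= !th_tr.
have hE : h _ (mcat s s') = tcat (h Y s) (h Y' s') by rewrite rmorphD /= !th_tr.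
rewrite fE hE.
have -> : tcat (f Y r) (f Y' r') * tcat (h Y s) (h Y' s') =
    tcat (f Y r * h Y s) (f Y' r' * h Y' s').
  by apply: (sm_inj (res_tr_mackey Q)); rewrite rmorphM !(tcatl, tcatr).
rewrite raddfD /=; congr (_ + _); apply: (sm_tr_eq (res_tr_mackey Q)); exact: gmap_ext.
Qed.

Lemma tlift_zmod X : zmod_morphism (@tlift_fun X).
Proof.
by move=> c c'; apply: (@addIr _ (tlift_fun c')); rewrite -tlift_add !subrK.
Qed.

(** A product is the norm along the fold of a sum of two transfers, so compatibility with norms,
    transfers and sums implies multiplicativity. *)
Lemma tlift_monoid X : monoid_morphism (@tlift_fun X).
Proof.
split=> [|c c'].
  by rewrite -pt1 tliftE (sm_tr_id (res_tr_mackey _)) !rmorph1 mulr1.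
by rewrite -!nm_fold tlift_nm tlift_add !tlift_tr.
Qed.

HB.instance Definition _ X :=
  GRing.isZmodMorphism.Build (T X) (Q X) (@tlift_fun X) (@tlift_zmod X).
HB.instance Definition _ X :=
  GRing.isMonoidMorphism.Build (T X) (Q X) (@tlift_fun X) (@tlift_monoid X).

Definition tlift_hom : tambara_hom T Q :=
  @TambaraHom _ T Q (fun X => @tlift_fun X) tlift_res tlift_tr tlift_nm.

Lemma tlift_inl X r : tlift_hom X (tinl X r) = f X r.
Proof. by rewrite /= tliftE (sm_tr_id (res_tr_mackey _)) rmorph1 mulr1. Qed.

Lemma tlift_inr X s : tlift_hom X (tinr X s) = h X s.
Proof. by rewrite /= tliftE (sm_tr_id (res_tr_mackey _)) rmorph1 mul1r. Qed.

Lemma tlift_unit X a : tlift_hom X (alg_unit tens_alg X a) = alg_unit Q X a.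
Proof. by rewrite [LHS]tlift_inl ah_unit. Qed.

Definition tlift : kalgebra_hom tens_alg Q :=
    @KAlgebraHom _ k tens_alg Q tlift_hom tlift_unit.

End Lift.

Lemma tens_uniq (Q : kalgebra k) (u v : kalgebra_hom tens_alg Q) :
    (forall X r, u X (tinl X r) = v X (tinl X r)) ->
    (forall X s, u X (tinr X s) = v X (tinr X s)) ->
  forall X x, u X x = v X x.
Proof.
move=> ul ur X x; have [Y [p [r [s ->]]]] := mkP x.
by rewrite tinlr !th_tr !rmorphM ul ur.
Qed.

Definition tens_box : algebra_box R S :=
  @AlgebraBox _ k R S tens_alg tinl tinr tlift tlift_inl tlift_inr tens_uniq.

End TensorAlgebra.

(** Bundles a proof of linearity, so that the general lemmas on linear maps apply to a pairing with
    one argument fixed. *)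
Definition pack_linear (A : pzRingType) (U V : lmodType A) (f : U -> V) (Hf : linear f) :
    {linear U -> V} :=
  HB.pack f (GRing.isLinear.Build A U V *:%R f Hf).

(** * The coend as target of the universal Dress pairing *)

Section CoendBox.

Variables (gT : finGroupType) (k : tambara gT) (M N : kmodule k).
Implicit Types X Y Z : gset gT.
Local Notation mk := (@cmk _ k M N _ _).
Local Notation C := (coend_module M N).

Definition cpair_fun X (m : M X) (n : N X) : C X := mk gmap_id m n.

Lemma cpair_linl X (n : N X) : linear (fun m : M X => cpair_fun m n).
Proof.
move=> a m m'; rewrite /cpair_fun mkDl; congr (_ + _).
by rewrite [RHS](@cZE _ _ M N) (sm_res_id (res_tr_mackey k)).
Qed.

Lemma cpair_linr X (m : M X) : linear (fun n : N X => cpair_fun m n).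
Proof.
move=> a n n'; rewrite /cpair_fun mkDr; congr (_ + _).
by rewrite [RHS](@cZE _ _ M N) (sm_res_id (res_tr_mackey k)) mkZ.
Qed.

Lemma cpair_res X Y (f : gmap X Y) (m : M Y) (n : N Y) :
  mres C f (cpair_fun m n) = cpair_fun (mres M f m) (mres N f n).
Proof. exact: cresE (pb_sym (pb_id f)). Qed.

Lemma cpair_tr X Y (f : gmap X Y) m n : mtr C f (cpair_fun m n) = mk f m n.
Proof. by rewrite [LHS](@ctrE _ _ M N); congr cmk; apply: gmap_ext. Qed.

Lemma mk_id_comp X Y (f : gmap X Y) m n : mk f m n = mk (gmap_id \og f) m n.
Proof. by congr cmk; apply: gmap_ext. Qed.

Lemma cpair_trl X Y (f : gmap X Y) (m : M X) (n : N Y) :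
  mtr C f (cpair_fun m (mres N f n)) = cpair_fun (mtr M f m) n.
Proof. by rewrite cpair_tr mk_id_comp mkL. Qed.

Lemma cpair_trr X Y (f : gmap X Y) (m : M Y) (n : N X) :
  mtr C f (cpair_fun (mres M f m) n) = cpair_fun m (mtr N f n).
Proof. by rewrite cpair_tr mk_id_comp mkR. Qed.

Definition cpair : pairing M N C :=
  Pairing cpair_linl cpair_linr cpair_res cpair_trl cpair_trr.

Section Lift.

Variables (T : kmodule k) (b : pairing M N T).

Lemma pairDl X (m m' : M X) (n : N X) :
  pr_fun b (m + m') n = pr_fun b m n + pr_fun b m' n.
Proof. exact: (raddfD (pack_linear (pr_linl b n))). Qed.

Lemma pairDr X (m : M X) (n n' : N X) :
  pr_fun b m (n + n') = pr_fun b m n + pr_fun b m n'.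
Proof. exact: (raddfD (pack_linear (pr_linr b m))). Qed.

Lemma pairZl X a (m : M X) (n : N X) : pr_fun b (a *: m) n = a *: pr_fun b m n.
Proof. exact: (linearZ_LR (pack_linear (pr_linl b n))). Qed.

Lemma pairZr X a (m : M X) (n : N X) : pr_fun b m (a *: n) = a *: pr_fun b m n.
Proof. exact: (linearZ_LR (pack_linear (pr_linr b m))). Qed.

Lemma pair_cat X Y (m : M X) (n : N X) (m' : M Y) (n' : N Y) :
  pr_fun b (mcat m m') (mcat n n') = mcat (pr_fun b m n) (pr_fun b m' n').
Proof. by apply: mcatE; rewrite pr_res ?mcatl ?mcatr. Qed.

Definition coend_lift_fun X (c : C X) : T X :=
  clift (fun Y (p : gmap Y X) (m : M Y) (n : N Y) => mtr T p (pr_fun b m n)) c.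

Lemma pair_bal X :
  balanced (fun Y (p : gmap Y X) (m : M Y) (n : N Y) => mtr T p (pr_fun b m n)).
Proof.
split=> [Y Y' p g m n|Y Y' p g m n|Y p a m n]; last by rewrite pairZl pairZr.
- by rewrite (sm_tr_comp (m_mackey T)) pr_trl.
- by rewrite (sm_tr_comp (m_mackey T)) pr_trr.
Qed.

Lemma coend_liftE X Y (p : gmap Y X) m n :
  coend_lift_fun (mk p m n) = mtr T p (pr_fun b m n).
Proof. exact: (cliftE (pair_bal X)). Qed.

Lemma coend_lift_add X (c c' : C X) :
  coend_lift_fun (c + c') = coend_lift_fun c + coend_lift_fun c'.
Proof.
have [Y [p [m [n ->]]]] := mkP c; have [Y' [p' [m' [n' ->]]]] := mkP c'.
by rewrite [_ + _](@mk_add _ _ M N) !coend_liftE pair_cat m_case.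
Qed.

Lemma coend_lift_linear X : linear (@coend_lift_fun X).
Proof.
move=> a c c'; rewrite coend_lift_add; congr (_ + _).
have [Y [p [m [n ->]]]] := mkP c.
by rewrite [a *: _](@cZE _ _ M N) !coend_liftE pairZl mtr_resl.
Qed.

Lemma coend_lift_res X Y (f : gmap X Y) c :
  coend_lift_fun (mres C f c) = mres T f (coend_lift_fun c).
Proof.
have [Z [p [m [n ->]]]] := mkP c; have P := pbkP p f.
rewrite [mres C f _](@cresE _ _ M N _ _ _ _ _ _ _ _ _ _ P) !coend_liftE.
by rewrite (sm_pullback (m_mackey T) P) pr_res.
Qed.

Lemma coend_lift_tr X Y (f : gmap X Y) c :
  coend_lift_fun (mtr C f c) = mtr T f (coend_lift_fun c).
Proof.
have [Z [p [m [n ->]]]] := mkP c.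
by rewrite [mtr C f _](@ctrE _ _ M N) !coend_liftE (sm_tr_comp (m_mackey T)).
Qed.

Definition coend_lift : kmodule_hom C T :=
  @KModuleHom _ k C T (fun X => pack_linear (@coend_lift_linear X))
    coend_lift_res coend_lift_tr.

End Lift.

Lemma coend_lift_pair T (b : pairing M N T) X (m : M X) (n : N X) :
  coend_lift b X (pr_fun cpair m n) = pr_fun b m n.
Proof. by rewrite [LHS]coend_liftE (sm_tr_id (m_mackey T)). Qed.

Lemma coend_hom_uniq T (u v : kmodule_hom C T) :
    (forall X (m : M X) (n : N X), u X (pr_fun cpair m n) = v X (pr_fun cpair m n)) ->
  forall X x, u X x = v X x.
Proof.
move=> uv X x; have [Y [p [m [n ->]]]] := mkP x.
by rewrite -cpair_tr !mh_tr uv.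
Qed.

Definition coend_box : module_box M N :=
  @ModuleBox _ k M N C cpair coend_lift coend_lift_pair coend_hom_uniq.

End CoendBox.

(** * Restriction of scalars for modules *)

Section Restriction.

Variables (gT : finGroupType) (k l : tambara gT) (phi : tambara_hom k l).
Implicit Types X Y Z : gset gT.

Section Object.

Variable N : kmodule l.

Section Level.

Variable X : gset gT.

Let scale (a : k X) (n : N X) : N X := phi X a *: n.

Lemma restr_scaleA a b n : scale a (scale b n) = scale (a * b) n.
Proof. by rewrite /scale scalerA rmorphM. Qed.

Lemma restr_scale1 : left_id 1 scale.
Proof. by move=> n; rewrite /scale rmorph1 scale1r. Qed.

Lemma restr_scaleDr : right_distributive scale +%R.
Proof. by move=> a n n'; rewrite /scale scalerDr. Qed.

Lemma restr_scaleDl n : {morph scale^~ n : a b / a + b}.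
Proof. by move=> a b; rewrite /scale rmorphD scalerDl. Qed.

(** Forgets the [l]-scaling, so that only the additive group is packed with the new scaling. *)
Let carrier : zmodType := N X.

Definition restr_lmod : lmodType (k X) :=
  HB.pack_for (lmodType (k X)) (GRing.Zmodule.sort carrier)
    (GRing.Zmodule_isLmodule.Build (k X) (GRing.Zmodule.sort carrier)
       restr_scaleA restr_scale1 restr_scaleDr restr_scaleDl).

End Level.

Let rres X Y (f : gmap X Y) : {additive restr_lmod Y -> restr_lmod X} := mres N f.
Let rtr X Y (f : gmap X Y) : {additive restr_lmod X -> restr_lmod Y} := mtr N f.

Lemma restr_mackey : @semi_mackey gT (fun X => restr_lmod X)
  (fun X Y f => rres f) (fun X Y f => rtr f).
Proof. exact: (m_mackey N). Qed.

Lemma restrZE X (a : k X) (n : N X) : a *: (n : restr_lmod X) = phi X a *: n.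
Proof. by []. Qed.

Lemma restr_resZ X Y (f : gmap X Y) (a : k Y) (m : restr_lmod Y) :
  rres f (a *: m) = res f a *: rres f m.
Proof. by rewrite !restrZE th_res; apply: mresZ. Qed.

Lemma restr_tr_resl X Y (f : gmap X Y) (a : k Y) (m : restr_lmod X) :
  rtr f (res f a *: m) = a *: rtr f m.
Proof. by rewrite !restrZE th_res; apply: mtr_resl. Qed.

Lemma restr_tr_resr X Y (f : gmap X Y) (a : k X) (m : restr_lmod Y) :
  rtr f (a *: rres f m) = tr f a *: m.
Proof. by rewrite !restrZE th_tr; apply: mtr_resr. Qed.

Definition restr : kmodule k :=
  KModule restr_mackey restr_resZ restr_tr_resl restr_tr_resr.

End Object.

Section Hom.

Variables (N N' : kmodule l) (f : kmodule_hom N N').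

Lemma restr_hom_linear X : linear (f X : restr N X -> restr N' X).
Proof. by move=> a n n'; rewrite raddfD; congr (_ + _); apply: (linearZ_LR (f X)). Qed.

Definition restr_hom : kmodule_hom (restr N) (restr N') :=
  @KModuleHom _ k (restr N) (restr N') (fun X => pack_linear (@restr_hom_linear X))
    (@mh_res _ _ _ _ f) (@mh_tr _ _ _ _ f).

End Hom.

End Restriction.

(** * Box products over [l] computed over [k] *)

Section Flatness.

Variables (gT : finGroupType) (k l : tambara gT) (phi : tambara_hom k l).
Variables (R : kalgebra k) (B : algebra_box R (KAlgebra phi)).
Implicit Types X Y Z : gset gT.
Local Notation M := (alg_module R).

Section Object.

Variable N : kmodule l.
Local Notation mk := (@cmk _ k M (restr phi N) _ _).

(** A separate name, since the coend already carries its [k]-scaling and receives an [l]-scaling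
    here. *)
Definition bc_level X : Type := coend M (restr phi N) X.

HB.instance Definition _ X := GRing.Zmodule.on (bc_level X).

Definition lscale X (a : l X) (c : bc_level X) : bc_level X :=
  clift (fun Y (f : gmap Y X) (m : M Y) (n : restr phi N Y) =>
    mk f m (res f a *: (n : N Y))) c.

Lemma lscale_bal X (a : l X) : balanced (M := M) (N := restr phi N)
  (fun Y (f : gmap Y X) (m : M Y) (n : restr phi N Y) =>
    mk f m (res f a *: (n : N Y))).
Proof.
split=> [Z Z' f g m n|Z Z' f g m n|Z f b m n].
- rewrite -mkL (sm_res_comp (res_tr_mackey l)); congr cmk.
  exact: (esym (@mresZ _ _ N _ _ g (res f a) n)).
- have E : res f a *: (mtr (restr phi N) g n : N Z) =
      mtr (restr phi N) g (res g (res f a) *: (n : N Z')).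
    exact: (esym (@mtr_resl _ _ N _ _ g (res f a) n)).
  by rewrite E -mkR (sm_res_comp (res_tr_mackey l)).
rewrite mkZ; congr cmk.
by rewrite [in LHS]restrZE [in RHS]restrZE !scalerA mulrC.
Qed.

Lemma lscaleE X (a : l X) Y (f : gmap Y X) m (n : N Y) :
  lscale a (mk f m n) = mk f m (res f a *: n).
Proof. exact: (cliftE (lscale_bal a)). Qed.

Lemma lscaleA X (a b : l X) c : lscale a (lscale b c) = lscale (a * b) c.
Proof.
by have [Y [f [m [n ->]]]] := mkP c; rewrite !lscaleE scalerA rmorphM.
Qed.

Lemma lscale1 X : left_id 1 (@lscale X).
Proof. by move=> c; have [Y [f [m [n ->]]]] := mkP c; rewrite lscaleE rmorph1 scale1r. Qed.

Lemma lscaleDr X : right_distributive (@lscale X) +%R.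
Proof.
move=> a c c'; have [Z [f [m [n ->]]]] := mkP c; have [Z' [f' [m' [n' ->]]]] := mkP c'.
rewrite [_ + _](@mk_add _ _ M (restr phi N)) !lscaleE [RHS](@mk_add _ _ M (restr phi N)).
congr cmk; apply: (@mcatE _ _ N); rewrite mresZ.
  rewrite [mres N _ _](@mcatl _ _ N) (sm_res_eq (res_tr_mackey l) (g := f)) //.
  exact: gmap_ext.
rewrite [mres N _ _](@mcatr _ _ N) (sm_res_eq (res_tr_mackey l) (g := f')) //.
exact: gmap_ext.
Qed.

Lemma lscaleDl X (c : bc_level X) : {morph (@lscale X)^~ c : a b / a + b}.
Proof.
move=> a b; have [Y [f [m [n ->]]]] := mkP c.
by rewrite !lscaleE raddfD scalerDl; apply: mkDr.
Qed.

HB.instance Definition _ X := GRing.Zmodule_isLmodule.Build (l X) (bc_level X)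
  (@lscaleA X) (@lscale1 X) (@lscaleDr X) (@lscaleDl X).

Definition bres X Y (f : gmap X Y) : bc_level Y -> bc_level X := @cres _ _ M (restr phi N) X Y f.
Definition btr X Y (f : gmap X Y) : bc_level X -> bc_level Y := @ctr _ _ M (restr phi N) X Y f.

HB.instance Definition _ X Y (f : gmap X Y) :=
  GRing.isZmodMorphism.Build (bc_level Y) (bc_level X) (bres f) (cresD f).
HB.instance Definition _ X Y (f : gmap X Y) :=
  GRing.isZmodMorphism.Build (bc_level X) (bc_level Y) (btr f) (ctrD f).

Lemma bZE X (a : l X) Y (f : gmap Y X) m (n : N Y) :
  a *: (mk f m n : bc_level X) = mk f m (res f a *: n).
Proof. exact: lscaleE. Qed.

Lemma bresE X Y Z W (f : gmap Z Y) (h : gmap X Y) (p : gmap W Z) (q : gmap W X) m n :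
  is_pullback f h p q -> bres h (mk f m n) = mk q (mres M p m) (mres N p n).
Proof. exact: cresE. Qed.

Lemma btrE X Y (h : gmap X Y) Z (f : gmap Z X) m n : btr h (mk f m n) = mk (h \og f) m n.
Proof. exact: ctrE. Qed.

Lemma bc_resZ X Y (h : gmap X Y) (a : l Y) (c : bc_level Y) :
  bres h (a *: c) = res h a *: bres h c.
Proof.
have [Z [f [m [n ->]]]] := mkP c; have P := pbkP f h.
rewrite bZE !(bresE _ _ P) bZE; congr cmk.
apply: etrans (@mresZ _ _ N _ _ (pbk1 f h) (res f a) n) _; congr (_ *: _).
rewrite -!(sm_res_comp (res_tr_mackey l)); congr (res _ a).
exact/gmap_ext/P.1.
Qed.

Lemma bc_tr_resl X Y (h : gmap X Y) (a : l Y) (c : bc_level X) :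
  btr h (res h a *: c) = a *: btr h c.
Proof.
have [Z [f [m [n ->]]]] := mkP c.
by rewrite bZE !btrE bZE (sm_res_comp (res_tr_mackey l)).
Qed.

Lemma bc_tr_resr X Y (h : gmap X Y) (a : l X) (c : bc_level Y) :
  btr h (a *: bres h c) = tr h a *: c.
Proof.
have [Z [f [m [n ->]]]] := mkP c; have P := pbkP f h.
have fq : f \og pbk1 f h = h \og pbk2 f h by apply/gmap_ext/P.1.
rewrite (bresE _ _ P) !bZE btrE -fq [LHS]mkR; congr cmk.
apply: etrans (@mtr_resr _ _ N _ _ (pbk1 f h) (res (pbk2 f h) a) n) _.
by rewrite (sm_pullback (res_tr_mackey l) (pb_sym P)).
Qed.

Definition bc_module : kmodule l := @KModule gT l bc_level
  (fun X Y f => bres f) (fun X Y f => btr f)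
  (coend_mackey M (restr phi N)) bc_resZ bc_tr_resl bc_tr_resr.

Local Notation L := (KAlgebra phi).
Local Notation T := (tens_alg R L).
Local Notation mkT := (@cmk _ k M (alg_module L) _ _).

(** The tensor product formula: by the projection formula, the transfer of [r (x) s] along [p] pairs
    with [n] to the transfer of [r (x) (s *: res_p n)]. *)
Definition bact X (c : T X) (n : N X) : bc_level X :=
  clift (fun Y (p : gmap Y X) (r : M Y) (s : alg_module L Y) =>
    mk p r ((s : l Y) *: mres N p n)) c.

Lemma bact_bal X (n : N X) : balanced (M := M) (N := alg_module L)
  (fun Y (p : gmap Y X) (r : M Y) (s : alg_module L Y) =>
    mk p r ((s : l Y) *: mres N p n)).
Proof.
split=> [Y Y' p g r s|Y Y' p g r s|Y p a r s].
- rewrite (sm_res_comp (m_mackey N)) -mkL; congr cmk.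
  exact: (esym (@mresZ _ _ N _ _ g s (mres N p n))).
- rewrite (sm_res_comp (m_mackey N)) [LHS]mkR; congr cmk.
  exact: (@mtr_resr _ _ N _ _ g s (mres N p n)).
rewrite mkZ restrZE; congr cmk; rewrite scalerA.
by rewrite [a *: s]/GRing.scale.
Qed.

Lemma actE X (n : N X) Y (p : gmap Y X) r (s : l Y) :
  bact (mkT p r s) n = mk p r (s *: mres N p n).
Proof. exact: (cliftE (bact_bal n)). Qed.

Lemma bact_addl X (c c' : T X) (n : N X) : bact (c + c') n = bact c n + bact c' n.
Proof.
have [Y [p [r [s ->]]]] := mkP c; have [Y' [p' [r' [s' ->]]]] := mkP c'.
rewrite [_ + _](@mk_add _ _ M (alg_module L)) !actE [RHS](@mk_add _ _ M (restr phi N)).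
congr cmk; apply: (@mcatE _ _ N); rewrite mresZ -(sm_res_comp (m_mackey N)).
  rewrite [res _ _](@mcatl _ _ (alg_module L)); congr (_ *: mres N _ _).
  exact: gmap_ext.
rewrite [res _ _](@mcatr _ _ (alg_module L)); congr (_ *: mres N _ _).
exact: gmap_ext.
Qed.

Lemma bact_addr X (c : T X) (n n' : N X) : bact c (n + n') = bact c n + bact c n'.
Proof.
have [Y [p [r [s ->]]]] := mkP c.
by rewrite !actE raddfD scalerDr; apply: mkDr.
Qed.

Lemma bact_scaler X (a : l X) (c : T X) (n : N X) : bact c (a *: n) = a *: bact c n.
Proof.
have [Y [p [r [s ->]]]] := mkP c.
by rewrite !actE bZE mresZ !scalerA mulrC.
Qed.

Lemma bact_scalel X (a : l X) (c : T X) (n : N X) :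
  bact (tinr R L X a * c) n = a *: bact c n.
Proof.
have [Y [p [r [s ->]]]] := mkP c.
have -> : tinr R L X a * mkT p r s = mkT p r (res p a * s).
  rewrite [mkT p r s]mk_pt mulrC -tr_mul_res -th_res.
  by rewrite [_ * _]ptM mulr1 mk_pt mulrC.
by rewrite !actE bZE scalerA.
Qed.

Lemma bact_res X Y (f : gmap X Y) (c : T Y) (n : N Y) :
  bres f (bact c n) = bact (res f c) (mres N f n).
Proof.
have [Z [p [r [s ->]]]] := mkP c; have P := pbkP p f.
have pf : p \og pbk1 p f = f \og pbk2 p f by apply/gmap_ext/P.1.
rewrite [res f _](@cresE _ _ M (alg_module L) _ _ _ _ _ _ _ _ _ _ P) !actE (bresE _ _ P).
congr cmk; apply: etrans (@mresZ _ _ N _ _ (pbk1 p f) s (mres N p n)) _.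
by rewrite -!(sm_res_comp (m_mackey N)) pf.
Qed.

Lemma bact_trl X Y (f : gmap X Y) (c : T X) (n : N Y) :
  btr f (bact c (mres N f n)) = bact (tr f c) n.
Proof.
have [Z [p [r [s ->]]]] := mkP c.
rewrite [tr f _](@ctrE _ _ M (alg_module L)) !actE btrE.
by rewrite (sm_res_comp (m_mackey N)).
Qed.

Lemma bact_trr X Y (f : gmap X Y) (c : T Y) (n : N X) :
  btr f (bact (res f c) n) = bact c (mtr N f n).
Proof.
have [Z [p [r [s ->]]]] := mkP c; have P := pbkP p f.
have pf : p \og pbk1 p f = f \og pbk2 p f by apply/gmap_ext/P.1.
rewrite [res f _](@cresE _ _ M (alg_module L) _ _ _ _ _ _ _ _ _ _ P) !actE btrE -pf [LHS]mkR.
congr cmk; apply: etrans (@mtr_resl _ _ N _ _ (pbk1 p f) s (mres N (pbk2 p f) n)) _.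
by rewrite (sm_pullback (m_mackey N) (pb_sym P)).
Qed.

(** Comparison of the arbitrary box product [B] with the explicit one. Through [theta] the pairing
    on triples becomes a pairing on [B], and [sigma] writes elements of [B] as transfers of
    products. *)
Let theta : kalgebra_hom B T := ab_lift B (tinl R L) (tinr R L).
Let sigma : kalgebra_hom T B := tlift (ab_inl B) (ab_inr B).

Lemma thetaK X b : sigma X (theta X b) = b.
Proof.
pose st : kalgebra_hom B B := @KAlgebraHom _ k B B (tambara_comp sigma theta)
  (fun X a => etrans (congr1 (sigma X) (ah_unit theta a)) (ah_unit sigma a)).
apply: (ab_uniq (u := st) (v := kalgebra_id B)) => Y x.
  by rewrite [LHS](congr1 (sigma Y) (ab_lift_inl _ _ _ _)) [LHS]tlift_inl.
by rewrite [LHS](congr1 (sigma Y) (ab_lift_inr _ _ _ _)) [LHS]tlift_inr.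
Qed.

Local Notation Bl := (alg_module (base_change B)).

Definition bpair_fun X (b : Bl X) (n : N X) : bc_module X := bact (theta X b) n.

Lemma bpair_linl X (n : N X) : linear (fun b : Bl X => bpair_fun b n).
Proof.
move=> a b b'; rewrite /bpair_fun.
have -> : theta X (a *: b + b') = tinr R L X a * theta X b + theta X b'.
  by rewrite [a *: b]/GRing.scale rmorphD rmorphM ab_lift_inr.
by rewrite bact_addl bact_scalel.
Qed.

Lemma bpair_linr X (b : Bl X) : linear (fun n : N X => bpair_fun b n).
Proof. by move=> a n n'; rewrite /bpair_fun bact_addr bact_scaler. Qed.

Lemma bpair_res X Y (f : gmap X Y) (b : Bl Y) (n : N Y) :
  mres bc_module f (bpair_fun b n) = bpair_fun (mres Bl f b) (mres N f n).
Proof. by rewrite [LHS]bact_res -th_res. Qed.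

Lemma bpair_trl X Y (f : gmap X Y) (b : Bl X) (n : N Y) :
  mtr bc_module f (bpair_fun b (mres N f n)) = bpair_fun (mtr Bl f b) n.
Proof. by rewrite [LHS]bact_trl -th_tr. Qed.

Lemma bpair_trr X Y (f : gmap X Y) (b : Bl Y) (n : N X) :
  mtr bc_module f (bpair_fun (mres Bl f b) n) = bpair_fun b (mtr N f n).
Proof. by rewrite /bpair_fun th_res; apply: bact_trr. Qed.

Definition bpair : pairing Bl N bc_module :=
  Pairing bpair_linl bpair_linr bpair_res bpair_trl bpair_trr.

Lemma bpair_inl X (r : R X) (n : N X) : bpair_fun (ab_inl B X r) n = mk gmap_id r n.
Proof.
rewrite /bpair_fun ab_lift_inl [LHS]actE scale1r.
by congr cmk; apply: (sm_res_id (m_mackey N)).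
Qed.

Lemma mk_bpair X Y (p : gmap Y X) r (n : N Y) :
  mk p r n = mtr bc_module p (bpair_fun (ab_inl B Y r) n).
Proof.
by rewrite bpair_inl [RHS]btrE; congr cmk; apply: gmap_ext.
Qed.

Lemma bpair_mk X (b : Bl X) (n : N X) : exists Y (p : gmap Y X) (r : R Y) (s : l Y),
  b = tr p (ab_inl B Y r * ab_inr B Y s) /\ bpair_fun b n = mk p r (s *: mres N p n).
Proof.
have [Y [p [r [s E]]]] := mkP (theta X b); exists Y, p, r, s; split.
  by rewrite -(thetaK b) E [LHS]tliftE.
by rewrite /bpair_fun E actE.
Qed.

Section Lift.

Variables (Q : kmodule l) (b : pairing Bl N Q).

Lemma bc_inlZ X (a : k X) (r : M X) :
  (ab_inl B X (a *: r) : Bl X) = phi X a *: (ab_inl B X r : Bl X).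
Proof.
rewrite [a *: r]/GRing.scale [RHS]/GRing.scale /= rmorphM !ah_unit.
by rewrite -(ah_unit (ab_inr B)).
Qed.

(** An [l]-bilinear pairing on [B] is restricted along [R -> B] to a [k]-bilinear one on [R], to
    which the universal property of the coend applies. *)
Definition rpair_fun X (r : M X) (n : restr phi N X) : restr phi Q X :=
  pr_fun b (ab_inl B X r : Bl X) n.

Lemma rpair_linl X (n : restr phi N X) : linear (fun r : M X => rpair_fun r n).
Proof.
move=> a r r'; rewrite /rpair_fun rmorphD bc_inlZ.
by rewrite (pairDl b) (pairZl b).
Qed.

Lemma rpair_linr X (r : M X) : linear (fun n : restr phi N X => rpair_fun r n).
Proof. by move=> a n n'; rewrite /rpair_fun (pairDr b) (pairZr b). Qed.

Lemma rpair_res X Y (f : gmap X Y) (r : M Y) (n : restr phi N Y) :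
  mres (restr phi Q) f (rpair_fun r n) = rpair_fun (mres M f r) (mres (restr phi N) f n).
Proof. by rewrite [LHS](pr_res b) /rpair_fun th_res. Qed.

Lemma rpair_trl X Y (f : gmap X Y) (r : M X) (n : restr phi N Y) :
  mtr (restr phi Q) f (rpair_fun r (mres (restr phi N) f n)) = rpair_fun (mtr M f r) n.
Proof. by rewrite [LHS](pr_trl b) /rpair_fun th_tr. Qed.

Lemma rpair_trr X Y (f : gmap X Y) (r : M Y) (n : restr phi N X) :
  mtr (restr phi Q) f (rpair_fun (mres M f r) n) = rpair_fun r (mtr (restr phi N) f n).
Proof. by rewrite /rpair_fun th_res [LHS](pr_trr b). Qed.

Definition rpair : pairing M (restr phi N) (restr phi Q) :=
  Pairing rpair_linl rpair_linr rpair_res rpair_trl rpair_trr.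

Let lift := coend_lift rpair.

Lemma bc_liftE X Y (p : gmap Y X) r (n : N Y) :
  lift X (mk p r n) = mtr Q p (pr_fun b (ab_inl B Y r : Bl Y) n).
Proof. exact: coend_liftE. Qed.

Lemma bc_lift_linear X : linear (lift X : bc_module X -> Q X).
Proof.
move=> a c c'; rewrite raddfD; congr (_ + _).
have [Y [p [m [n ->]]]] := mkP c.
rewrite [a *: _]bZE; apply: etrans (bc_liftE p m (res p a *: n)) _.
rewrite (pairZr b) mtr_resl.
exact: (congr1 (fun x : Q X => a *: x) (esym (bc_liftE p m n))).
Qed.

Definition bc_lift : kmodule_hom bc_module Q :=
  @KModuleHom _ l bc_module Q (fun X => pack_linear (@bc_lift_linear X))
    (@mh_res _ _ _ _ lift) (@mh_tr _ _ _ _ lift).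

Lemma bc_lift_pair X (x : Bl X) (n : N X) :
  bc_lift X (pr_fun bpair x n) = pr_fun b x n.
Proof.
have [Y [p [r [s [-> E]]]]] := bpair_mk x n.
rewrite [pr_fun bpair _ _]E [LHS]bc_liftE.
(* By [l]-bilinearity [s] passes from the module to the factor in [B], and Frobenius reciprocity
   then reassembles the transfer that presents [x]. *)
rewrite (pairZr b) -(pairZl b) (pr_trl b).
by congr (pr_fun b (tr p _) n); rewrite [LHS]/GRing.scale mulrC.
Qed.

End Lift.

Lemma bc_hom_uniq Q (u v : kmodule_hom bc_module Q) :
    (forall X (x : Bl X) (n : N X), u X (pr_fun bpair x n) = v X (pr_fun bpair x n)) ->
  forall X x, u X x = v X x.
Proof.
move=> uv X x; have [Y [p [m [n ->]]]] := mkP x.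
by rewrite mk_bpair !mh_tr uv.
Qed.

Definition bc_box : module_box Bl N :=
  @ModuleBox _ l Bl N bc_module bpair bc_lift bc_lift_pair bc_hom_uniq.

End Object.

Section Comparison.

Variables (N N' : kmodule l) (f : kmodule_hom N N').

(** The two box products have the same underlying sets and differ only in scalars. The same function
    is therefore induced over [l] and over [k], which is what transports exactness. *)
Lemma bc_map X (c : bc_box N X) : module_box_map (bc_box N) (bc_box N') f X c =
  module_box_map (coend_box M (restr phi N)) (coend_box M (restr phi N'))
    (restr_hom phi f) X c.
Proof.
have [Y [p [m [n ->]]]] := mkP c.
by rewrite [LHS](bc_liftE (N := N)) [RHS]coend_liftE /= [LHS](congr1 _ (bpair_inl _ _)).
Qed.

End Comparison.

End Flatness.

(** * Independence of the choice of box product, and transport of exactness *)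

Section BoxIso.

Variables (gT : finGroupType) (k : tambara gT) (M : kmodule k).

Section Iso.

Variables (N : kmodule k) (B C : module_box M N).

Definition box_iso : kmodule_hom B C := mb_lift B (mb_pair C).

End Iso.

Definition kmodule_hom_comp (P Q U : kmodule k) (u : kmodule_hom Q U) (v : kmodule_hom P Q) :
  kmodule_hom P U.
Proof.
refine (@KModuleHom _ k P U (fun X => u X \o v X) _ _) => X Y f m /=.
- by rewrite !mh_res.
- by rewrite !mh_tr.
Defined.

Definition kmodule_hom_id (P : kmodule k) : kmodule_hom P P :=
  @KModuleHom _ k P P (fun X => idfun) (fun _ _ _ _ => erefl) (fun _ _ _ _ => erefl).

Lemma box_isoK N (B C : module_box M N) X : cancel (box_iso B C X) (box_iso C B X).
Proof.
move=> x; apply: (mb_uniq (u := kmodule_hom_comp (box_iso C B) (box_iso B C))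
  (v := kmodule_hom_id B)) => Y m n /=.
by rewrite !mb_liftE.
Qed.

Lemma box_iso_nat N N' (f : kmodule_hom N N') (B C : module_box M N)
    (B' C' : module_box M N') X x :
  box_iso B' C' X (module_box_map B B' f X x) = module_box_map C C' f X (box_iso B C X x).
Proof.
apply: (mb_uniq (u := kmodule_hom_comp (box_iso B' C') (module_box_map B B' f))
  (v := kmodule_hom_comp (module_box_map C C' f) (box_iso B C))) => Y m n /=.
by rewrite /module_box_map /box_iso mb_liftE /= !mb_liftE.
Qed.

End BoxIso.

(** The two sequences live over different Tambara functors, so they are compared by bare levelwise
    bijections. Exactness mentions only the maps and zero. *)
Lemma short_exact_iso (gT : finGroupType) (k l : tambara gT)
    (L M N : kmodule k) (f : kmodule_hom L M) (h : kmodule_hom M N)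
    (L' M' N' : kmodule l) (f' : kmodule_hom L' M') (h' : kmodule_hom M' N')
    (u : forall X, L X -> L' X) (v : forall X, M X -> M' X) (w : forall X, N X -> N' X) :
    (forall X, bijective (u X)) -> (forall X, bijective (v X)) ->
    (forall X, bijective (w X)) -> (forall X, w X 0 = 0) ->
    (forall X x, f' X (u X x) = v X (f X x)) ->
    (forall X x, h' X (v X x) = w X (h X x)) ->
  short_exact f h -> short_exact f' h'.
Proof.
move=> ub vb wb w0 fE hE ex X.
have [ui uK iuK] := ub X; have [vi vK ivK] := vb X; have [wi wK iwK] := wb X.
have [fi hs fh] := ex X; split.
- move=> x y; rewrite -(iuK x) -(iuK y) !fE.
  by move=> /(can_inj vK) /fi ->.
- move=> n; have [m hm] := hs (wi n); exists (v X m).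
  by rewrite hE hm iwK.
move=> m; rewrite -(ivK m) hE; split.
  rewrite -(w0 X) => /(can_inj wK) /fh [a <-].
  by exists (u X a).
move=> [a]; rewrite -(iuK a) fE => /(can_inj vK) E.
by rewrite (fh _).2 ?w0 //; exists (ui a).
Qed.

Lemma flat_base_change (gT : finGroupType) (k l : tambara gT) (phi : tambara_hom k l)
    (R : kalgebra k) (B : algebra_box R (KAlgebra phi)) :
  flat (alg_module R) -> flat (alg_module (base_change B)).
Proof.
case=> T Tex; exists (fun N => bc_box B N) => N1 N2 N3 f h fh.
(* Exactness is a condition on underlying functions, which restriction of scalars leaves
   unchanged. *)
have rfh : short_exact (restr_hom phi f) (restr_hom phi h) by [].
pose C N := coend_box (alg_module R) (restr phi N).
pose i N := box_iso (T (restr phi N)) (C N).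
have ib N X : bijective (i N X) by exists (box_iso (C N) (T (restr phi N)) X) => x; apply: box_isoK.
pose u N X x : bc_box B N X := i N X x.
apply: (@short_exact_iso _ k l _ _ _ _ _ _ _ _ _ _ (u N1) (u N2) (u N3) _ _ _ _ _ _
  (Tex _ _ _ _ _ rfh)) => //.
- by move=> X; apply: (ib N1 X).
- by move=> X; apply: (ib N2 X).
- by move=> X; apply: (ib N3 X).
- by move=> X; exact: (raddf0 (i N3 X)).
- by move=> X x; rewrite [LHS]bc_map; exact: (esym (box_iso_nat _ (C N1) (T _) (C N2) x)).
- by move=> X x; rewrite [LHS]bc_map; exact: (esym (box_iso_nat _ (C N2) (T _) (C N3) x)).
Qed.

Definition kalgebra_comp (gT : finGroupType) (k : tambara gT) (P Q U : kalgebra k)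
    (u : kalgebra_hom Q U) (v : kalgebra_hom P Q) : kalgebra_hom P U :=
  @KAlgebraHom _ k P U (tambara_comp u v)
    (fun X a => etrans (congr1 (u X) (ah_unit v a)) (ah_unit u a)).

(** * Base change of algebras as left adjoint to restriction of scalars *)

Section BaseChangeAlgebra.

Variables (gT : finGroupType) (k l : tambara gT) (phi : tambara_hom k l).
Local Notation L := (KAlgebra phi).

Definition restr_alg (A : kalgebra l) : kalgebra k :=
  KAlgebra (tambara_comp (alg_unit A) phi).

Definition restr_alg_hom (A A' : kalgebra l) (f : kalgebra_hom A A') :
    kalgebra_hom (restr_alg A) (restr_alg A') :=
  @KAlgebraHom _ k (restr_alg A) (restr_alg A') f (fun X a => ah_unit f (phi X a)).

Definition unit_hom (A : kalgebra l) : kalgebra_hom L (restr_alg A) :=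
  @KAlgebraHom _ k L (restr_alg A) (alg_unit A) (fun X a => erefl).

Section Universal.

Variables (R : kalgebra k) (B : algebra_box R L).

Lemma bc_unitE X a : alg_unit B X a = ab_inr B X (phi X a).
Proof. by rewrite -(ah_unit (ab_inr B)). Qed.

Definition bc_inl : kalgebra_hom R (restr_alg (base_change B)) :=
  @KAlgebraHom _ k R (restr_alg (base_change B)) (ab_inl B)
    (fun X a => etrans (ah_unit (ab_inl B) a) (bc_unitE a)).

Definition bc_hom (A : kalgebra l) (f : kalgebra_hom R (restr_alg A)) :
    kalgebra_hom (base_change B) A :=
  @KAlgebraHom _ l (base_change B) A (ab_lift B f (unit_hom A))
    (fun X a => ab_lift_inr B f (unit_hom A) a).

Lemma bc_hom_inl (A : kalgebra l) (f : kalgebra_hom R (restr_alg A)) X r :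
  bc_hom f X (bc_inl X r) = f X r.
Proof. exact: (ab_lift_inl B f (unit_hom A) r). Qed.

(** On the factor [l] both maps are forced by compatibility with the units, so only the values on
    [R] remain to be compared. *)
Lemma bc_alg_uniq (A : kalgebra l) (u v : kalgebra_hom (base_change B) A) :
  (forall X r, u X (bc_inl X r) = v X (bc_inl X r)) -> forall X x, u X x = v X x.
Proof.
have unit (w : kalgebra_hom (base_change B) A) X a :
    w X (alg_unit B X a) = alg_unit (restr_alg A) X a.
  by rewrite bc_unitE; apply: (ah_unit w).
pose r (w : kalgebra_hom (base_change B) A) : kalgebra_hom B (restr_alg A) :=
  @KAlgebraHom _ k B (restr_alg A) w (unit w).
move=> uv; apply: (ab_uniq (u := r u) (v := r v)) => // X s.
by rewrite [LHS](ah_unit u) [RHS](ah_unit v).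
Qed.

End Universal.

Definition bc_alg_map (R S : kalgebra k) (B : algebra_box R L) (C : algebra_box S L)
    (f : kalgebra_hom R S) : kalgebra_hom (base_change B) (base_change C) :=
  bc_hom B (kalgebra_comp (bc_inl C) f).

Lemma bc_alg_mapE (R S : kalgebra k) (B : algebra_box R L) (C : algebra_box S L)
    (f : kalgebra_hom R S) X r :
  bc_alg_map B C f X (bc_inl B X r) = bc_inl C X (f X r).
Proof. exact: bc_hom_inl. Qed.

Section Free.

Variables (n : nat) (K : 'I_n -> gset gT) (F : free_algebra k K) (B : algebra_box F L).

Let gen i : base_change B (K i) := bc_inl B (K i) (fa_gen F i).

Let lift (A : kalgebra l) (r : forall i, A (K i)) : kalgebra_hom (base_change B) A :=
  bc_hom B (fa_lift F (R := restr_alg A) r).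

Lemma bc_free_liftE (A : kalgebra l) (r : forall i, A (K i)) i : lift r (K i) (gen i) = r i.
Proof. by rewrite [LHS]bc_hom_inl fa_liftE. Qed.

Lemma bc_free_uniq (A : kalgebra l) (u v : kalgebra_hom (base_change B) A) :
  (forall i, u (K i) (gen i) = v (K i) (gen i)) -> forall X x, u X x = v X x.
Proof.
move=> uv; apply: bc_alg_uniq.
exact: (fa_uniq (u := kalgebra_comp (restr_alg_hom u) (bc_inl B))
  (v := kalgebra_comp (restr_alg_hom v) (bc_inl B))).
Qed.

(** Restriction of scalars does not change the levels [A (K i)], so the base change of a free
    algebra represents the same functor, now on [l]-algebras. *)
Definition bc_free : free_algebra l K :=
  @FreeAlgebra _ l n K (base_change B) gen lift bc_free_liftE bc_free_uniq.

End Free.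

(** Left adjoints preserve coequalizers: a map out of the base change of [T] is tested on [T],
    factored through [R] over [k], and extended back to [l]. *)
Lemma bc_coequalizer (S T R : kalgebra k) (u v : kalgebra_hom S T) (q : kalgebra_hom T R)
    (BS : algebra_box S L) (BT : algebra_box T L) (BR : algebra_box R L) :
  is_coequalizer u v q ->
  is_coequalizer (bc_alg_map BS BT u) (bc_alg_map BS BT v) (bc_alg_map BT BR q).
Proof.
case=> quv qU; split.
  apply: (bc_alg_uniq (u := kalgebra_comp (bc_alg_map BT BR q) (bc_alg_map BS BT u))
    (v := kalgebra_comp (bc_alg_map BT BR q) (bc_alg_map BS BT v))) => X r.
  by rewrite /= !bc_alg_mapE quv.
move=> A f fuv.
have [|h0 [h0q h0U]] := qU _ (kalgebra_comp (restr_alg_hom f) (bc_inl BT)).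
  by move=> X x; have /= := fuv X (bc_inl BS X x); rewrite !bc_alg_mapE.
exists (bc_hom BR h0); split.
  apply: (bc_alg_uniq (u := kalgebra_comp (bc_hom BR h0) (bc_alg_map BT BR q)) (v := f)) => X t.
  by rewrite /= bc_alg_mapE [LHS]bc_hom_inl h0q.
move=> h' h'q; apply: bc_alg_uniq => X r; rewrite [RHS]bc_hom_inl.
apply: (h0U (kalgebra_comp (restr_alg_hom h') (bc_inl BR))) => Y t /=.
by rewrite -h'q bc_alg_mapE.
Qed.

Lemma finitely_presented_base_change (R : kalgebra k) (B : algebra_box R L) :
  finitely_presented R -> finitely_presented (base_change B).
Proof.
case=> [m [n [K [K' [S [T [u [v [q quv]]]]]]]]].
(* The free algebras get the explicit box products with [l]; the base change of [R] itself uses the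
   given [B]. *)
exists m, n, K, K', (bc_free (tens_box S L)), (bc_free (tens_box T L)).
do 3!eexists; exact: bc_coequalizer quv.
Qed.

Section SelfBox.

Variables (R : kalgebra k) (B : algebra_box R L).
Variables (D : algebra_box R R) (B2 : algebra_box D L).

Let inl : kalgebra_hom (base_change B) (base_change B2) := bc_alg_map B B2 (ab_inl D).
Let inr : kalgebra_hom (base_change B) (base_change B2) := bc_alg_map B B2 (ab_inr D).

Let lift (A : kalgebra l) (f h : kalgebra_hom (base_change B) A) :
    kalgebra_hom (base_change B2) A :=
  bc_hom B2 (ab_lift D (kalgebra_comp (restr_alg_hom f) (bc_inl B))
                       (kalgebra_comp (restr_alg_hom h) (bc_inl B))).

Lemma self_lift_inl (A : kalgebra l) (f h : kalgebra_hom (base_change B) A) X x :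
  lift f h X (inl X x) = f X x.
Proof.
apply: (bc_alg_uniq (u := kalgebra_comp (lift f h) inl) (v := f)) => Y r.
by rewrite /= bc_alg_mapE [LHS]bc_hom_inl ab_lift_inl.
Qed.

Lemma self_lift_inr (A : kalgebra l) (f h : kalgebra_hom (base_change B) A) X x :
  lift f h X (inr X x) = h X x.
Proof.
apply: (bc_alg_uniq (u := kalgebra_comp (lift f h) inr) (v := h)) => Y r.
by rewrite /= bc_alg_mapE [LHS]bc_hom_inl ab_lift_inr.
Qed.

Lemma self_uniq (A : kalgebra l) (u v : kalgebra_hom (base_change B2) A) :
    (forall X x, u X (inl X x) = v X (inl X x)) ->
    (forall X x, u X (inr X x) = v X (inr X x)) ->
  forall X x, u X x = v X x.
Proof.
move=> ul ur; apply: bc_alg_uniq.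
apply: (ab_uniq (u := kalgebra_comp (restr_alg_hom u) (bc_inl B2))
  (v := kalgebra_comp (restr_alg_hom v) (bc_inl B2))) => X r /=.
  by have := ul X (bc_inl B X r); rewrite /= bc_alg_mapE.
by have := ur X (bc_inl B X r); rewrite /= bc_alg_mapE.
Qed.

(** Base change commutes with coproducts: boxing [R] with itself over [k] and then with [l] gives
    the coproduct over [l] of two copies of the base change of [R]. *)
Definition self_box : algebra_box (base_change B) (base_change B) :=
  @AlgebraBox _ l _ _ (base_change B2) inl inr lift self_lift_inl self_lift_inr self_uniq.

Lemma self_box_mul X d :
  box_mul self_box X (bc_inl B2 X d) = bc_inl B X (box_mul D X d).
Proof.
rewrite [LHS]bc_hom_inl.
apply: (ab_uniq (u := ab_lift D (kalgebra_comp (restr_alg_hom (kalgebra_id (base_change B))) (bc_inl B))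
    (kalgebra_comp (restr_alg_hom (kalgebra_id (base_change B))) (bc_inl B)))
  (v := kalgebra_comp (bc_inl B) (box_mul D))) => Y r.
  by rewrite ab_lift_inl /= ab_lift_inl.
by rewrite ab_lift_inr /= ab_lift_inr.
Qed.

End SelfBox.

End BaseChangeAlgebra.

(** * Kähler differentials under base change, and the theorem *)

Section Kahler.

Variable gT : finGroupType.

Lemma ideal_generatedB (S : tambara gT) (F : Defs.family S) X x y :
  ideal_generated F x -> ideal_generated F y -> ideal_generated F (x - y : S X).
Proof.
move=> Fx Fy I IT FI; have [T [f If]] := IT.
have fx : f X x = 0 := (If _ _).1 (Fx I IT FI).
have fy : f X y = 0 := (If _ _).1 (Fy I IT FI).
by apply/If; rewrite /Defs.ker raddfB /= fx fy subr0.
Qed.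

(** Removes the cosets: the quotient of [I] by [I^{>1}] is trivial exactly when [I] is contained in
    [I^{>1}]. *)
Lemma kahler_eq0P (k : tambara gT) (R : kalgebra k) (B : algebra_box R R) :
  kahler_eq0 B <->
  forall X (x : B X), Defs.ker (box_mul B) x -> ideal_gt1 (Defs.ker (box_mul B)) x.
Proof.
rewrite /kahler_eq0; split=> H X; last first.
  move=> C [x [Ix CE]] y; have {}Ix := H X x Ix.
  rewrite CE; split=> [yx|Iy]; last exact: ideal_generatedB.
  (* Written with differences only, as closure under subtraction is the available property. *)
  have -> : y = (y - x) - ((x - x) - x) by rewrite subrr sub0r opprK subrK.
  by do 3![apply: ideal_generatedB => //].
move=> x Ix; apply/(H X (fun y => ideal_gt1 (Defs.ker (box_mul B)) (y - x))).
  by exists x.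
by rewrite subrr => I [T [f If]] _; apply/If; rewrite /Defs.ker rmorph0.
Qed.

(* A Tambara ideal J containing all nontrivial norms of I' = ker(B2 -> B)
   pulls back along D -> B2 to an ideal containing I^{>1} = I; so the quotient
   map h by J kills I, its restriction to D factors through D -> R, and by the
   universal property of B2 the map h itself factors through B2 -> B. *)
Lemma kahler_trivial_base_change (k l : tambara gT) (phi : tambara_hom k l)
    (R : kalgebra k) (B : algebra_box R (KAlgebra phi)) :
  kahler_trivial R -> kahler_trivial (base_change B).
Proof.
case=> D /kahler_eq0P D0; pose B2 := tens_box D (KAlgebra phi).
exists (self_box B B2); apply/kahler_eq0P => X x Ix J [T [h Jh]] J1; apply/Jh; rewrite /Defs.ker.
pose j := bc_inl B2.
have Ij Y d : Defs.ker (box_mul D) d -> Defs.ker (box_mul (self_box B B2)) (j Y d).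
  by rewrite /Defs.ker self_box_mul => ->; rewrite rmorph0.
have hj Y d : Defs.ker (box_mul D) d -> h Y (j Y d) = 0.
  move=> /D0 Id; apply: (Id (Defs.ker (tambara_comp h j))).
    by exists T, (tambara_comp h j).
  move=> Z _ [H a b Ia Ib|H K f a HK Ia]; rewrite /Defs.ker /=.
    apply: (etrans (congr1 (h _) (rmorphM (j _) a b))).
    by apply/Jh/J1/NormProduct; apply: Ij.
  apply: (etrans (congr1 (h _) (th_nm j f a))).
  by apply/Jh/J1/NormSubgroup => //; apply: Ij.
pose TA : kalgebra l := KAlgebra (tambara_comp h (alg_unit (base_change B2))).
pose hA : kalgebra_hom (base_change B2) TA :=
  @KAlgebraHom _ l (base_change B2) TA h (fun _ _ => erefl).
pose g : kalgebra_hom R (restr_alg phi TA) :=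
  kalgebra_comp (restr_alg_hom phi hA) (kalgebra_comp j (ab_inl D)).
have hE : forall Y y, h Y y = bc_hom B g Y (box_mul (self_box B B2) Y y).
  apply: (bc_alg_uniq (u := hA)
    (v := kalgebra_comp (bc_hom B g) (box_mul (self_box B B2)))) => Y d.
  have E := etrans (congr1 (bc_hom B g Y) (self_box_mul B B2 d)) (bc_hom_inl B g _).
  apply: (etrans _ (esym E)); apply/eqP; rewrite -subr_eq0; apply/eqP.
  (* [ab_inl D] splits the multiplication, so the difference lies in its kernel, where [h] vanishes.
     The factorisation through [R] is thus given explicitly by [ab_inl D]. *)
  have : h Y (j Y (d - ab_inl D Y (box_mul D Y d))) = 0.
    by apply: hj; rewrite /Defs.ker rmorphB ab_lift_inl subrr.
  by rewrite (rmorphB (j Y)) (rmorphB (h Y)).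
by rewrite hE Ix rmorph0.
Qed.

End Kahler.

Theorem proposition4p7 (gT : finGroupType) (k l : tambara gT)
    (phi : tambara_hom k l) (R : kalgebra k)
    (B : algebra_box R (KAlgebra phi)) :
  [/\ finitely_presented R -> finitely_presented (base_change B),
      flat (alg_module R) -> flat (alg_module (base_change B)),
      kahler_trivial R -> kahler_trivial (base_change B) &
      etale R -> etale (base_change B)].
Proof.
have fp := @finitely_presented_base_change gT k l phi R B.
have fl := @flat_base_change gT k l phi R B.
have ka := @kahler_trivial_base_change gT k l phi R B.
by split=> // -[[/fl ? /ka ?] /fp ?].
Qed.
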